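(* Let $D\subset\mathbb{R}^d$ be compact and let $A\in C(D,\mathbb{R}^{m\times n})$. For integers $r\ge 2$ and $p,\ell\ge 2$, let $\Omega\in\mathbb{R}^{n\times(r+p)}$ and $\Psi\in\mathbb{R}^{m\times(r+p+\ell)}$ be independent Gaussian random matrices (not depending on $t$). Then $$\mathbb{E}\Big[\int_{D}\|(I-\mathcal{P}_{A(t)\Omega,\Psi})A(t)\|^2_F\,\mathrm{d}t\Big]\leq\Big(1+\frac{r+p}{\ell-1}\Big)\Big(1+\frac{r}{p-1}\Big)\int_{D}\sum_{j>r}\sigma_j(A(t))^2\,\mathrm{d}t.$$
   Context: $C(D,\mathbb{R}^{m\times n})$ is the set of continuous functions from $D$ to $\mathbb{R}^{m\times n}$. A Gaussian random matrix is a matrix whose entries are i.i.d. standard normal random variables. For $B\in\mathbb{R}^{m\times n}$, $\mathcal{P}_{B\Omega,\Psi}:=B\Omega(\Psi^TB\Omega)^\dagger\Psi^T$, where $\dagger$ denotes the Moore–Penrose pseudoinverse; so $\mathcal{P}_{A(t)\Omega,\Psi}A(t)=(A(t)\Omega)(\Psi^TA(t)\Omega)^\dagger(\Psi^TA(t))$ (generalized Nyström approximation). $\|\cdot\|_F$ is the Frobenius norm and $\sigma_1(M)\ge\sigma_2(M)\ge\cdots$ are the singular values of $M$ (the sum over $j>r$ runs over $r<j\le\min\{m,n\}$, an empty sum being $0$). Integration over $D$ is with respect to Lebesgue measure. *)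

(* Defs.v *)
From HB Require Import structures.
From mathcomp Require Import all_boot all_order all_algebra.
From mathcomp Require Import polyrcf.
From mathcomp Require Import all_classical all_reals all_analysis.

Set Implicit Arguments.
Unset Strict Implicit.
Unset Printing Implicit Defensive.

Import Order.TTheory GRing.Theory Num.Theory.
Import numFieldNormedType.Exports.

Local Open Scope classical_set_scope.
Local Open Scope ring_scope.

(* Matrices over a measurable type carry the sigma-algebra generated by their
   entries; over the reals this is the Borel sigma-algebra. *)
Definition measure_mx_display : measure_display -> measure_display.
Proof. exact. Qed.

Section measurable_mx.
Context d (T : measurableType d) (m n : nat).

Definition mx_measurable : set (set 'M[T]_(m, n)) :=
  <<s \bigcup_(ij in [set: 'I_m * 'I_n])
        preimage_set_system setT (fun M : 'M[T]_(m, n) => M ij.1 ij.2)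
          measurable >>.

Let mx_measurable0 : mx_measurable set0.
Proof. exact: sigma_algebra0. Qed.

Let mx_measurableC A : mx_measurable A -> mx_measurable (~` A).
Proof. exact: sigma_algebraC. Qed.

Let mx_measurable_bigcup (F : _^nat) :
  (forall i, mx_measurable (F i)) -> mx_measurable (\bigcup_i (F i)).
Proof. exact: sigma_algebra_bigcup. Qed.

HB.instance Definition _ := @isMeasurable.Build (measure_mx_display d)
  'M[T]_(m, n) mx_measurable mx_measurable0 mx_measurableC mx_measurable_bigcup.

End measurable_mx.

Lemma measurable_mx_entry d (T : measurableType d) (m n : nat) i j :
  measurable_fun setT (fun M : 'M[T]_(m, n) => M i j).
Proof.
move=> _ B mB; rewrite setTI; apply: sub_sigma_algebra.
by exists (i, j) => //; exists B => //; rewrite setTI.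
Qed.

Lemma measurable_fun_mxP d d' (S : measurableType d') (T : measurableType d)
    (m n : nat) (f : S -> 'M[T]_(m, n)) :
  measurable_fun setT f <->
  forall i j, measurable_fun setT (fun x => f x i j).
Proof.
split=> [mf i j|mf].
  exact: (measurableT_comp (measurable_mx_entry i j) mf).
pose G := \bigcup_(ij in [set: 'I_m * 'I_n])
        preimage_set_system setT (fun M : 'M[T]_(m, n) => M ij.1 ij.2)
          measurable.
apply: (@measurability _ _ _ _ setT f G) => //.
move=> _ [_ [[i j] _ [B mB <-]] <-].
rewrite !setTI; have := mf i j measurableT _ mB.
by rewrite setTI.
Qed.


Definition row_cons (R : Type) (d : nat) (xv : R * 'rV[R]_d) : 'rV[R]_(1 + d) :=
  row_mx (const_mx xv.1 : 'rV_1) xv.2.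

Lemma row_cons0 (R : Type) d (xv : R * 'rV[R]_d) :
  (row_cons xv : 'rV_d.+1) ord0 ord0 = xv.1.
Proof.
transitivity ((row_cons xv) ord0 (lshift d ord0)).
  by congr (fun_of_matrix _ _ _); exact/val_inj.
by rewrite /row_cons row_mxEl mxE.
Qed.

Lemma row_consS (R : Type) d (xv : R * 'rV[R]_d) i :
  (row_cons xv : 'rV_d.+1) ord0 (lift ord0 i) = xv.2 ord0 i.
Proof.
transitivity ((row_cons xv) ord0 (rshift 1 i)).
  by congr (fun_of_matrix _ _ _); exact/val_inj.
by rewrite /row_cons row_mxEr.
Qed.

(* d-dimensional Lebesgue measure as the d-fold product of the one-dimensional
   one, with R^d seen as row vectors; d = 0 gives the unit mass on a point. *)
Fixpoint lebesgue_rV (R : realType) (d : nat) : set 'rV[R]_d -> \bar R :=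
  match d return set 'rV[R]_d -> \bar R with
  | 0%N => \d_(const_mx 0 : 'rV[R]_0)
  | d'.+1 => fun A => (\int[lebesgue_measure]_x
      lebesgue_rV [set v : 'rV[R]_d' | A (row_cons (x, v))])%E
  end.

Lemma product_sigma_finite d1 d2 (T1 : measurableType d1)
    (T2 : measurableType d2) (R : realType)
    (m1 : {sigma_finite_measure set T1 -> \bar R})
    (m2 : {sigma_finite_measure set T2 -> \bar R}) :
  sigma_finite setT (m1 \x m2)%E.
Proof.
have /sigma_finiteP[F [TF ndF Foo]] := sigma_finiteT m1.
have /sigma_finiteP[G [TG ndG Goo]] := sigma_finiteT m2.
exists (fun n => F n `*` G n).
  rewrite -setXTT TF TG predeqE => -[x y]; split.
    move=> [/= [n _ Fnx] [k _ Gky]]; exists (maxn n k) => //; split.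
    - by move: x Fnx; exact/subsetPset/ndF/leq_maxl.
    - by move: y Gky; exact/subsetPset/ndG/leq_maxr.
  by move=> [n _ []/= ? ?]; split; exists n.
move=> k; have [? ?] := Foo k; have [? ?] := Goo k.
split; first exact: measurableX.
by rewrite product_measure1E// lte_mul_pinfty// ge0_fin_numE.
Qed.

Lemma pushforward_sigma_finite d1 d2 (T1 : measurableType d1)
    (T2 : measurableType d2) (R : realType) (m : {measure set T1 -> \bar R})
    (f : T1 -> T2) (g : T2 -> T1) :
  measurable_fun setT f -> measurable_fun setT g -> cancel f g ->
  sigma_finite setT m ->
  exists nu : {sigma_finite_measure set T2 -> \bar R},
    nu = pushforward m f :> (set T2 -> \bar R).
Proof.
move=> mf mg fK [F FT Foo].
have [nu nuE] : exists nu : {measure set T2 -> \bar R},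
    nu = pushforward m f :> (set T2 -> \bar R).
  by unshelve (eexists; reflexivity).
case: nu nuE => nu cnu /= nuE.
have nu_sf : sigma_finite setT nu.
  exists (fun k => g @^-1` F k); first by rewrite -preimage_bigcup -FT.
  move=> k; have [mF Flty] := Foo k; split.
    by rewrite -[X in measurable X]setTI; exact: mg.
  by rewrite nuE /pushforward -comp_preimage (_ : g \o f = id)//; apply/funext.
pose nuS := Measure_isSigmaFinite.Build _ T2 R (Measure.Pack cnu) nu_sf.
pose nu' : {sigma_finite_measure set T2 -> \bar R} := HB.pack nu cnu nuS.
by exists nu'.
Qed.

Arguments lebesgue_rV {R d}.

Section lebesgue_rV_measure.
Context (R : realType).

Lemma measurable_row_cons d :
  measurable_fun setT (@row_cons R d : measurableTypeR R * 'rV[R]_d -> _).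
Proof.
apply/measurable_fun_mxP => i j; rewrite /row_cons.
case: (splitP j) => k jk.
  rewrite (_ : (fun _ => _) = fst); first exact: measurable_fst.
  apply/funext => xv.
  by rewrite (_ : j = lshift d k) ?row_mxEl ?mxE//; apply/val_inj.
rewrite (_ : (fun _ => _) = (fun v : 'rV[R]_d => v i k) \o snd).
  apply: measurableT_comp => //; exact: measurable_mx_entry.
apply/funext => xv /=.
by rewrite (_ : j = rshift 1 k) ?row_mxEr//; apply/val_inj.
Qed.

Lemma measurable_row_cons_inv d : measurable_fun setT
  (fun v : 'rV[R]_(1 + d) => (v 0 (lshift d 0), rsubmx v) : measurableTypeR R * _).
Proof.
apply/measurable_fun_pairP; split => /=.
  exact: measurable_mx_entry.
apply/measurable_fun_mxP => i j.
rewrite (_ : (fun _ => _) = (fun v : 'rV[R]_(1 + d) => v i (rshift 1 j))).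
  exact: measurable_mx_entry.
by apply/funext => v; rewrite /= mxE.
Qed.

Let row_consK d : cancel (@row_cons R d)
  (fun v : 'rV[R]_(1 + d) => (v 0 (lshift d 0), rsubmx v)).
Proof. by case=> x v; rewrite /row_cons/= row_mxEl mxE row_mxKr. Qed.

Lemma lebesgue_rV_sigma_finite_measure d :
  exists mu : {sigma_finite_measure set 'rV[R]_d -> \bar R},
    @lebesgue_rV R d = mu.
Proof.
elim: d => [|d [mu muE]].
  by exists [the {sigma_finite_measure set _ -> \bar R} of
    \d_(const_mx 0 : 'rV[R]_0)].
have [nu nuE] := pushforward_sigma_finite (@measurable_row_cons d)
  (@measurable_row_cons_inv d) (@row_consK d)
  (product_sigma_finite (@lebesgue_measure R) mu).
exists nu; rewrite nuE; apply/funext => A.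
rewrite /= /pushforward/= /product_measure1; apply: eq_integral => x _ /=.
rewrite muE; congr (mu _); apply/seteqP; split => v /=; by rewrite /xsection/= inE.
Qed.
Let lebesgue_rV0 d : lebesgue_rV (set0 : set 'rV[R]_d) = 0%E.
Proof. by have [mu ->] := lebesgue_rV_sigma_finite_measure d; exact: measure0. Qed.

Let lebesgue_rV_ge0 d (A : set 'rV[R]_d) : (0 <= lebesgue_rV A)%E.
Proof. by have [mu ->] := lebesgue_rV_sigma_finite_measure d. Qed.

Let lebesgue_rV_sigma_additive d : semi_sigma_additive (@lebesgue_rV R d).
Proof.
have [mu ->] := lebesgue_rV_sigma_finite_measure d.
exact: measure_semi_sigma_additive.
Qed.

HB.instance Definition _ d := isMeasure.Build _ 'rV[R]_d R (@lebesgue_rV R d)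
  (@lebesgue_rV0 d) (@lebesgue_rV_ge0 d) (@lebesgue_rV_sigma_additive d).

Let lebesgue_rV_sigma_finite d : sigma_finite setT (@lebesgue_rV R d).
Proof.
by have [mu ->] := lebesgue_rV_sigma_finite_measure d; exact: sigma_finiteT.
Qed.

HB.instance Definition _ d := Measure_isSigmaFinite.Build _ 'rV[R]_d R
  (@lebesgue_rV R d) (@lebesgue_rV_sigma_finite d).

Lemma lebesgue_rV_box d (a b : 'I_d -> R) : (forall i, a i <= b i) ->
  lebesgue_rV [set v | forall i, v 0 i \in `[a i, b i]] =
  (\prod_i (b i - a i))%:E.
Proof.
elim: d a b => [|d IH] a b ab.
  rewrite big_ord0 /= diracE mem_set//= => -[].
  by [].
rewrite big_ord_recl /=.
set c := \prod_(i < d) _.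
transitivity (\int[@lebesgue_measure R]_x ((cst c%:E) \_ `[a ord0, b ord0]) x)%E.
  apply: eq_integral.
  move=> x _; rewrite patchE.
  have [xab|xab] := boolP (x \in `[a ord0, b ord0]).
    rewrite mem_set//= -(IH (a \o lift ord0) (b \o lift ord0)); last first.
      by move=> i; exact: ab.
    congr lebesgue_rV; apply/seteqP; split => v /= vab i.
      by have := vab (lift ord0 i); rewrite row_consS.
    by case: (unliftP ord0 i) => [j|] ->; rewrite ?row_consS ?row_cons0.
  rewrite memNset /=; last exact/negP.
  rewrite (_ : [set _ | _] = set0) ?measure0//.
  apply/seteqP; split => // v /= /(_ ord0).
  by rewrite row_cons0 (negPf xab).
rewrite -integral_mkcond integral_cst//= lebesgue_measure_itv/= lte_fin.
rewrite muleC EFinM; case: ltgtP (ab ord0) => // -> _.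
by rewrite subrr.
Qed.

End lebesgue_rV_measure.

Definition frobenius_norm (R : realType) (m n : nat) (M : 'M[R]_(m, n)) : R :=
  Num.sqrt (\sum_i \sum_j M i j ^+ 2).

Definition is_moore_penrose (R : realType) (m n : nat) (M : 'M[R]_(m, n))
    (X : 'M[R]_(n, m)) : Prop :=
  [/\ M *m X *m M = M, X *m M *m X = X,
      (M *m X)^T = M *m X & (X *m M)^T = X *m M].

Definition moore_penrose (R : realType) (m n : nat) (M : 'M[R]_(m, n)) :
  'M[R]_(n, m) := xget 0 [set X | is_moore_penrose M X].

Lemma moore_penrose_unique (R : realType) (m n : nat) (M : 'M[R]_(m, n)) X Y :
  is_moore_penrose M X -> is_moore_penrose M Y -> X = Y.
Proof.
move=> [X1 X2 X3 X4] [Y1 Y2 Y3 Y4].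
have MXY : M *m X = M *m Y.
  rewrite -X3 -{1}Y1 -(mulmxA (M *m Y)) trmx_mul X3 Y3.
  by rewrite mulmxA X1.
have XYM : X *m M = Y *m M.
  rewrite -X4 -{1}Y1 -(mulmxA M) mulmxA trmx_mul X4 Y4.
  by rewrite -mulmxA (mulmxA M) X1.
by rewrite -X2 XYM -mulmxA MXY mulmxA Y2.
Qed.

Lemma gram_unitmx (R : realType) (r n : nat) (F : 'M[R]_(r, n)) :
  row_free F -> F *m F^T \in unitmx.
Proof.
move=> Ffree; rewrite -row_free_unit; apply/row_freeP; apply/row_freeP.
rewrite -kermx_eq0; apply/eqP/row_matrixP => i; rewrite row0.
set x := row i _.
have xG : x *m (F *m F^T) = 0 by rewrite /x -row_mul mulmx_ker row0.
have /matrixP/(_ 0 0) : (x *m F) *m (x *m F)^T = 0.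
  by rewrite trmx_mul mulmxA -(mulmxA x) xG mul0mx.
rewrite !mxE => /eqP; rewrite psumr_eq0; last first.
  by move=> j _; rewrite [_^T _ _]mxE -expr2 sqr_ge0.
move=> /allP xF0; apply: (row_free_inj Ffree); rewrite mul0mx.
apply/rowP => j; rewrite [RHS]mxE.
have := xF0 j (mem_index_enum _); rewrite [_^T _ _]mxE -expr2 sqrf_eq0.
by move/eqP.
Qed.

Lemma moore_penroseP (R : realType) (m n : nat) (M : 'M[R]_(m, n)) :
  is_moore_penrose M (moore_penrose M).
Proof.
suff [X MX] : exists X, is_moore_penrose M X by apply: xgetPex; exists X.
have [r [C [F [MCF uF uC]]]] : exists r (C : 'M[R]_(m, r)) (F : 'M[R]_(r, n)),
    [/\ M = C *m F, F *m F^T \in unitmx & C^T *m C \in unitmx].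
  exists (\rank M), (col_base M), (row_base M); split.
  - by rewrite mulmx_base.
  - by apply: gram_unitmx; exact: row_base_free.
  - rewrite -[X in _ *m X]trmxK; apply: gram_unitmx.
    by rewrite /row_free mxrank_tr; exact: col_base_full.
have VF : (invmx (F *m F^T))^T = invmx (F *m F^T).
  by rewrite trmx_inv trmx_mul trmxK.
have VC : (invmx (C^T *m C))^T = invmx (C^T *m C).
  by rewrite trmx_inv trmx_mul trmxK.
pose X := F^T *m invmx (F *m F^T) *m invmx (C^T *m C) *m C^T.
have MX : M *m X = C *m invmx (C^T *m C) *m C^T.
  rewrite MCF /X !mulmxA -(mulmxA C F) -(mulmxA C (F *m F^T)).
  by rewrite mulmxV// mulmx1.
have XM : X *m M = F^T *m invmx (F *m F^T) *m F.
  rewrite MCF /X !mulmxA -[X in X *m F]mulmxA -(mulmxA _ (invmx (C^T *m C))).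
  by rewrite mulVmx// mulmx1.
exists X; split.
- rewrite MX {1}MCF !mulmxA -[X in X *m F]mulmxA -(mulmxA C).
  by rewrite mulVmx// mulmx1 -MCF.
- rewrite XM /X !mulmxA -(mulmxA (F^T *m _) F) -(mulmxA F^T (invmx _)).
  by rewrite mulVmx// mulmx1.
- by rewrite MX !trmx_mul trmxK VC mulmxA.
- by rewrite XM !trmx_mul trmxK VF mulmxA.
Qed.

Definition nystrom_proj (R : realType) (m n k s : nat) (B : 'M[R]_(m, n))
    (Omega : 'M[R]_(n, k)) (Psi : 'M[R]_(m, s)) : 'M[R]_m :=
  B *m Omega *m moore_penrose (Psi^T *m (B *m Omega)) *m Psi^T.

(* Eigenvalues of S that lie in R, in nonincreasing order and repeated according to
   their algebraic multiplicity. *)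
Definition eigenvalues (R : realType) (n : nat) (S : 'M[R]_n) : seq R :=
  flatten [seq nseq (mup x (char_poly S)) x | x <- rev (rootsR (char_poly S))].

(* 0-indexed: (singular_values M)`_j is the (j+1)-st largest singular value.
   The list has n entries; those past the first minn m n are zero. *)
Definition singular_values (R : realType) (m n : nat) (M : 'M[R]_(m, n)) :
  seq R := [seq Num.sqrt x | x <- eigenvalues (M^T *m M)].

Section random_matrices.
Context d (T : measurableType d) (R : realType) (P : probability T R).

Definition standard_normal (X : T -> R) : Prop :=
  forall B, measurable B -> P (X @^-1` B) = normal_prob 0 1 B.

Definition mutually_independent (I : finType) (X : I -> T -> R) : Prop :=
  forall (J : {set I}) (B : I -> set R), (forall i, measurable (B i)) ->
    P (\bigcap_(i in [set` J]) (X i @^-1` B i)) =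
      (\prod_(i in J) P (X i @^-1` B i))%E.

Definition gaussian_matrix (m n : nat) (X : {RV P >-> 'M[R]_(m, n)}) : Prop :=
  (forall i j, standard_normal (fun w => X w i j)) /\
  mutually_independent (fun (ij : 'I_m * 'I_n) w => X w ij.1 ij.2).

Definition independent_RVs d1 d2 (T1 : measurableType d1)
    (T2 : measurableType d2) (X : {RV P >-> T1}) (Y : {RV P >-> T2}) : Prop :=
  forall A B, measurable A -> measurable B ->
    P (X @^-1` A `&` Y @^-1` B) = (P (X @^-1` A) * P (Y @^-1` B))%E.

End random_matrices.

(* Main.v *)
(* By Tonelli's theorem it suffices to bound the expected error for a fixed
   matrix B. Let the columns of Q be an orthonormal basis of the range of
   B Omega, and let E = (I - Q Q^T) B and G = Psi^T Q. If G has full column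
   rank, the squared error is |E|^2 + |G^+ Psi^T E|^2, and
   |E|^2 <= |B - B Omega C|^2 for every C; taking C from the top right singular
   vectors of B turns the expectation over Omega into one of the same kind as
   the expectation over Psi. Both are estimated with G^+ replaced by M G^T,
   where M = (G^T G + e I)^-1. Gaussian integration by parts in every entry of
   the s-row matrix Psi^T, applied to the field G M Q^T, gives
   E tr M <= q / (s - q - 1); applied to G M^2 G^T Psi^T E E^T, it gives
   E |M G^T Psi^T E|^2 = |E|^2 E |M G^T|^2 <= |E|^2 E tr M because Q^T E = 0.
   These bounds are uniform in e, so neither rotation invariance nor the inverse
   Wishart distribution is needed, and e tends to 0 by Fatou's lemma. *)

Require Import Defs.
From HB Require Import structures.
From mathcomp Require Import all_boot all_order all_algebra.
From mathcomp Require Import perm polyrcf ring lra.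
From mathcomp Require Import all_classical all_reals all_analysis.
From mathcomp Require Import measurable_realfun.

Set Implicit Arguments.
Unset Strict Implicit.
Unset Printing Implicit Defensive.

Import Order.TTheory GRing.Theory Num.Theory.
Import numFieldNormedType.Exports.

Local Open Scope classical_set_scope.
Local Open Scope ring_scope.

(** * Frobenius norm and regularized inverse Gram matrices *)

(** The pseudoinverse [G^+] jumps where [G] loses rank and is unbounded nearby, so it cannot serve
    as a field for integration by parts. For [e > 0] the entries of [M] and of [G M] are bounded in
    terms of [e] alone, so the fields used grow at most linearly and Gaussian second moments
    suffice. In the divergence of [G M Q^T] the number [tr M] receives the coefficient [s] and, up
    to terms with a factor [e], [-q] from products of two traces and [-1] from a single trace. This
    is where [s - q - 1] comes from; the terms with [e] have a favourable sign. The left sketch has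
    [s = r + p + l] and [q <= r + p], the right one [s = r + p] and [q <= r]. Since
    [q / (s - q - 1)] increases with [q], the two factors are [(r + p) / (l - 1)] and
    [r / (p - 1)]. *)

Section frobenius.
Context (R : realType).

(** The squared Frobenius norm, written as a trace so that cyclicity and orthogonality relations
    apply directly. *)
Definition nsq (m n : nat) (A : 'M[R]_(m, n)) : R := \tr (A^T *m A).

Lemma nsqE m n (A : 'M[R]_(m, n)) : nsq A = \sum_i \sum_j A i j ^+ 2.
Proof.
rewrite /nsq /mxtrace exchange_big; apply: eq_bigr => j _; rewrite mxE.
by apply: eq_bigr => i _; rewrite mxE -expr2.
Qed.

Lemma frobenius_norm_sqr m n (A : 'M[R]_(m, n)) : frobenius_norm A ^+ 2 = nsq A.
Proof.
rewrite nsqE sqr_sqrtr//; apply: sumr_ge0 => i _; apply: sumr_ge0 => j _.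
exact: sqr_ge0.
Qed.

Lemma nsq_ge0 m n (A : 'M[R]_(m, n)) : 0 <= nsq A.
Proof. by rewrite -frobenius_norm_sqr sqr_ge0. Qed.

Lemma nsqT m n (A : 'M[R]_(m, n)) : nsq A^T = nsq A.
Proof. by rewrite /nsq trmxK mxtrace_mulC. Qed.

Lemma nsqN m n (A : 'M[R]_(m, n)) : nsq (- A) = nsq A.
Proof. by rewrite /nsq [(- A)^T]linearN/= mulNmx mulmxN opprK. Qed.

Lemma nsqZ m n c (A : 'M[R]_(m, n)) : nsq (c *: A) = c ^+ 2 * nsq A.
Proof. by rewrite /nsq [(_ *: A)^T]linearZ/= -scalemxAl -scalemxAr scalerA mxtraceZ. Qed.

Lemma nsqD_orth m n (A B : 'M[R]_(m, n)) : A^T *m B = 0 ->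
  nsq (A + B) = nsq A + nsq B.
Proof.
move=> AB; have BA : B^T *m A = 0 by rewrite -[A]trmxK -trmx_mul AB trmx0.
by rewrite /nsq [(A + B)^T]linearD/= mulmxDl !mulmxDr AB BA addr0 add0r mxtraceD.
Qed.

Lemma nsq_mul_orth m n p (Q : 'M[R]_(m, n)) (A : 'M[R]_(n, p)) :
  Q^T *m Q = 1%:M -> nsq (Q *m A) = nsq A.
Proof. by move=> QQ; rewrite /nsq trmx_mul mulmxA -(mulmxA A^T) QQ mulmx1. Qed.

Lemma sqr_entry_le_nsq m n (A : 'M[R]_(m, n)) i j : A i j ^+ 2 <= nsq A.
Proof.
rewrite nsqE (bigD1 i)//= (bigD1 j)//= -addrA lerDl addr_ge0//.
  by apply: sumr_ge0 => *; exact: sqr_ge0.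
by apply: sumr_ge0 => k _; apply: sumr_ge0 => *; exact: sqr_ge0.
Qed.

Lemma nsq_eq0 m n (A : 'M[R]_(m, n)) : nsq A = 0 -> A = 0.
Proof.
move=> A0; apply/matrixP => i j; rewrite mxE; apply/eqP.
by rewrite -sqrf_eq0 eq_le sqr_ge0 andbT -A0 sqr_entry_le_nsq.
Qed.

(** Expanding the nonnegative sum of the [(v a_i - w b_i) ^+ 2] gives [v (u v - w ^+ 2)]. When
    [v = 0] every [b_i] vanishes. *)
Lemma sum_cauchy_schwarz (I : finType) (a b : I -> R) :
  (\sum_i a i * b i) ^+ 2 <= (\sum_i a i ^+ 2) * (\sum_i b i ^+ 2).
Proof.
set u := \sum_i a i ^+ 2; set v := \sum_i b i ^+ 2; set w := \sum_i a i * b i.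
have v0 : 0 <= v by apply: sumr_ge0 => i _; exact: sqr_ge0.
have : 0 <= \sum_i (v * a i - w * b i) ^+ 2.
  by apply: sumr_ge0 => i _; exact: sqr_ge0.
have -> : \sum_i (v * a i - w * b i) ^+ 2 = v * (u * v - w ^+ 2).
  rewrite (eq_bigr (fun i => v ^+ 2 * a i ^+ 2 - v * w * 2 * (a i * b i) +
    w ^+ 2 * b i ^+ 2)); last by move=> i _; ring.
  rewrite big_split/= sumrB -!mulr_sumr -/u -/v -/w; ring.
move: v0; rewrite le_eqVlt => /predU1P[v0 _|v0].
  have b0 i : b i = 0.
    apply/eqP; rewrite -sqrf_eq0 eq_le sqr_ge0 andbT v0 /v (bigD1 i)//= lerDl.
    by apply: sumr_ge0 => *; exact: sqr_ge0.
  rewrite /w big1 ?expr0n/= -?v0 ?mulr0// => i _; by rewrite b0 mulr0.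
by rewrite pmulr_rge0// subr_ge0.
Qed.

Lemma nsq_mul_le m n p (A : 'M[R]_(m, n)) (B : 'M[R]_(n, p)) :
  nsq (A *m B) <= nsq A * nsq B.
Proof.
rewrite !nsqE mulr_suml; apply: ler_sum => i _.
rewrite [X in _ * X]exchange_big mulr_sumr; apply: ler_sum => j _.
by rewrite mxE; exact: sum_cauchy_schwarz.
Qed.

End frobenius.

Section resolvent.
Context (R : realType).

(** Tikhonov regularization: [resolvent e G *m G^T] tends to the pseudoinverse of [G] as [e] tends
    to 0. *)
Definition resolvent (b q : nat) (e : R) (G : 'M[R]_(b, q)) : 'M[R]_q :=
  invmx (G^T *m G + e%:M).

Context (b q : nat) (e : R) (G : 'M[R]_(b, q)).
Hypothesis e0 : 0 < e.
Local Notation M := (resolvent e G).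

Lemma regularized_gram_unitmx : G^T *m G + e%:M \in unitmx.
Proof.
rewrite -row_free_unit -kermx_eq0; apply/eqP/row_matrixP => i; rewrite row0.
set x := row i _.
have xN : x *m (G^T *m G + e%:M) = 0 by rewrite /x -row_mul mulmx_ker row0.
have : nsq (x *m G^T)^T + e * nsq x^T = 0.
  have := congr1 (fun z => \tr (z *m x^T)) xN.
  rewrite mul0mx mxtrace0 => <-.
  rewrite /nsq !trmxK mulmxDr mulmxDl mul_mx_scalar -scalemxAl mxtraceD mxtraceZ.
  by rewrite trmx_mul trmxK !mulmxA.
move/eqP; rewrite paddr_eq0 ?nsq_ge0 ?mulr_ge0 ?nsq_ge0 ?ltW//.
rewrite mulf_eq0 (gt_eqF e0)/= => /andP[_ /eqP/nsq_eq0 x0].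
by rewrite -[x]trmxK x0 trmx0.
Qed.

Lemma resolvent_tr : M^T = M.
Proof.
by rewrite /resolvent trmx_inv linearD/= trmx_mul trmxK tr_scalar_mx.
Qed.

Lemma resolvent_mul_gram : M *m (G^T *m G) = 1%:M - e *: M.
Proof.
have /mulVmx := regularized_gram_unitmx.
by rewrite -/M mulmxDr mul_mx_scalar => <-; rewrite addrK.
Qed.

Lemma gram_mul_resolvent : G^T *m G *m M = 1%:M - e *: M.
Proof.
have /mulmxV := regularized_gram_unitmx.
by rewrite -/M mulmxDl mul_scalar_mx => <-; rewrite addrK.
Qed.

Lemma tr_gram_mul_resolvent : \tr (G^T *m G *m M) = q%:R - e * \tr M.
Proof. by rewrite gram_mul_resolvent linearB/= mxtraceZ mxtrace1. Qed.

(** The source of the bounds below: [M] is the sum of the positive semidefinite matrices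
    [(G M)^T (G M)] and [e M^T M], so each of them is controlled by [M]. *)
Lemma gram_mul_resolventE : (G *m M)^T *m (G *m M) = M - e *: (M^T *m M).
Proof.
rewrite trmx_mul resolvent_tr -mulmxA (mulmxA G^T) gram_mul_resolvent.
by rewrite mulmxBr mulmx1 -scalemxAr.
Qed.

Lemma nsq_mul_resolvent_eq : nsq (G *m M) = \tr M - e * nsq M.
Proof. by rewrite /nsq gram_mul_resolventE linearB/= mxtraceZ. Qed.

Lemma nsq_mul_resolvent_le : nsq (G *m M) <= \tr M.
Proof. by rewrite nsq_mul_resolvent_eq gerBl mulr_ge0 ?nsq_ge0 ?ltW. Qed.

Lemma nsq_resolvent_le : e * nsq M <= \tr M.
Proof. by rewrite -subr_ge0 -nsq_mul_resolvent_eq nsq_ge0. Qed.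

Lemma tr_resolvent_ge0 : 0 <= \tr M.
Proof. by apply: le_trans nsq_resolvent_le; rewrite mulr_ge0 ?nsq_ge0 ?ltW. Qed.

Let diag_resolventE j :
  \sum_k (G *m M) k j ^+ 2 + e * \sum_k M k j ^+ 2 = M j j.
Proof.
have /matrixP/(_ j j) := gram_mul_resolventE; rewrite !mxE.
under eq_bigr => k _ do rewrite mxE -expr2.
under [X in e * X]eq_bigr => k _ do rewrite mxE -expr2.
by move=> ->; rewrite subrK.
Qed.

Let sqr_le_sum n (f : 'I_n -> R) k : f k ^+ 2 <= \sum_i f i ^+ 2.
Proof.
by rewrite (bigD1 k)//= lerDl; apply: sumr_ge0 => *; exact: sqr_ge0.
Qed.

(** Keeping a single square of the diagonal identity leaves [e * M j j ^+ 2 <= M j j]. *)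
Let diag_resolvent_le j : M j j <= e^-1.
Proof.
have h : e * M j j ^+ 2 <= M j j.
  rewrite -[leRHS]diag_resolventE -[leLHS]add0r lerD//.
    by apply: sumr_ge0 => *; exact: sqr_ge0.
  by rewrite ler_pM2l//; exact: (sqr_le_sum (M ^~ j)).
have [Mj0|Mj0] := leP (M j j) 0.
  by apply: (le_trans Mj0); rewrite invr_ge0 ltW.
by rewrite -[leRHS]mul1r ler_pdivlMr// mulrC -(ler_pM2r Mj0) mul1r -mulrA -expr2.
Qed.

Lemma sqr_mul_resolvent_le k j : (G *m M) k j ^+ 2 <= e^-1.
Proof.
apply: le_trans (diag_resolvent_le j); rewrite -[leRHS]diag_resolventE.
rewrite -[leLHS]addr0 lerD//; first exact: (sqr_le_sum ((G *m M) ^~ j)).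
by rewrite mulr_ge0 ?(ltW e0)//; apply: sumr_ge0 => *; exact: sqr_ge0.
Qed.

Lemma norm_resolvent_le k j : `|M k j| <= e^-1.
Proof.
rewrite -(@ler_pXn2r _ 2)// ?nnegrE ?invr_ge0 ?(ltW e0)// real_normK ?num_real//.
rewrite [leRHS]expr2 ler_pdivlMl//; apply: le_trans (diag_resolvent_le j).
rewrite -[leRHS]diag_resolventE -[leLHS]add0r lerD//.
  by apply: sumr_ge0 => *; exact: sqr_ge0.
by rewrite ler_pM2l//; exact: (sqr_le_sum (M ^~ j)).
Qed.

(** A kernel vector of [G] is an eigenvector of [M] for [e^-1]. Hence [nsq M >= e^-1 ^+ 2], and
    [tr M] dominates [e * nsq M]. *)
Lemma tr_resolvent_ge_of_ker (x : 'cV[R]_q) :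
  x != 0 -> G *m x = 0 -> e^-1 <= \tr M.
Proof.
move=> x0 Gx0; apply: le_trans nsq_resolvent_le.
have Mx : M *m x = e^-1 *: x.
  apply: (scalerI (lt0r_neq0 e0)); rewrite scalerA divff ?gt_eqF// scale1r.
  have /(congr1 (mulmx^~ x)) := resolvent_mul_gram.
  rewrite mulmxBl mul1mx -!mulmxA Gx0 !mulmx0 -scalemxAl => /esym/eqP.
  by rewrite subr_eq0 => /eqP.
have nx0 : 0 < nsq x.
  by rewrite lt_neqAle nsq_ge0 andbT eq_sym; apply: contra_neq x0 => /nsq_eq0.
have := nsq_mul_le M x; rewrite Mx nsqZ ler_pM2r// expr2.
by rewrite ler_pdivrMl.
Qed.

End resolvent.

Section moore_penrose_limit.
Context (R : realType).

(** Since [G^T G X = G^T], one has [M G^T = X - e M X]. Writing [X = G^T G Z] turns [M X] into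
    [Z - e M Z], where [e M] has entries at most 1. So the error is [e] times a quantity bounded
    independently of [e]; the factor 2 in the constant pays for [Z] and for [e M Z]. *)
Lemma moore_penrose_resolvent_bound b q (G : 'M[R]_(b, q)) :
  exists K, forall e i j, 0 < e ->
    `|moore_penrose G i j - (resolvent e G *m G^T) i j| <= K * e.
Proof.
set X := moore_penrose G.
have [GXG XGX GXT XGT] : is_moore_penrose G X := moore_penroseP G.
pose Z := X *m X^T *m X.
have XZ : X = G^T *m G *m Z.
  have X1 : X = G^T *m X^T *m X by rewrite -trmx_mul XGT XGX.
  have X2 : X^T = G *m X *m X^T by rewrite -GXT -trmx_mul mulmxA XGX.
  by rewrite {1}X1 {1}X2 /Z !mulmxA.
exists (2 * \sum_i \sum_j `|Z i j|) => e i j e0.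
have -> : X i j - (resolvent e G *m G^T) i j =
    e * (Z i j - e * (resolvent e G *m Z) i j).
  have -> : resolvent e G *m G^T = X - e *: (Z - e *: (resolvent e G *m Z)).
    have GT : G^T = (G^T *m G + e%:M) *m X - e *: X.
      rewrite mulmxDl mul_scalar_mx addrK -mulmxA -GXT trmx_mul mulmxA.
      by rewrite -!trmx_mul mulmxA GXG.
    rewrite {1}GT mulmxBr mulmxA mulVmx ?regularized_gram_unitmx// mul1mx.
    congr (_ - _); rewrite -scalemxAr; congr (_ *: _).
    by rewrite {1}XZ mulmxA resolvent_mul_gram// mulmxBl mul1mx scalemxAl.
  by rewrite !mxE; ring.
rewrite normrM gtr0_norm// mulrC ler_pM2r// mulr_natl mulr2n.
have sub k : `|Z k j| <= \sum_i \sum_j `|Z i j|.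
  rewrite (bigD1 k)//= (bigD1 j)//= -addrA lerDl addr_ge0//.
    exact: sumr_ge0.
  by apply: sumr_ge0 => *; exact: sumr_ge0.
apply: (le_trans (ler_normB _ _)); rewrite lerD//.
rewrite mxE mulr_sumr; apply: (le_trans (ler_norm_sum _ _ _)).
apply: ler_sum => k _; rewrite !normrM mulrA -[leRHS]mulr1.
apply: (@le_trans _ _ `|Z k j|).
  rewrite ler_piMl// (gtr0_norm e0) -ler_pdivlMl// mulr1.
  exact: norm_resolvent_le.
by rewrite mulr1 (bigD1 j)//= lerDl sumr_ge0.
Qed.

Lemma moore_penrose_full_col b q (G : 'M[R]_(b, q)) X :
  X *m G = 1%:M -> (G *m X)^T = G *m X -> X = moore_penrose G.
Proof.
move=> XG GXT; apply: (@moore_penrose_unique _ _ _ G); last exact: moore_penroseP.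
by split; rewrite -?mulmxA ?XG ?mulmx1 ?mulmxA ?XG ?mul1mx// trmx1.
Qed.

End moore_penrose_limit.

(** * Orthonormal bases of a range and the Nystrom error *)

Section orthonormal_range.
Context (R : realType).

(** Gram-Schmidt, adding the first column to a basis for the others. The matrix [Z] certifies that
    the columns of [Q] lie in the range of [Y]. *)
Lemma orthonormal_range_basis m k (Y : 'M[R]_(m, k)) :
  exists q (Q : 'M[R]_(m, q)) (Z : 'M[R]_(k, q)),
    [/\ (q <= k)%N, Q^T *m Q = 1%:M, Y = Q *m Q^T *m Y & Q = Y *m Z].
Proof.
elim: k Y => [|k IH] Y.
  exists 0%N, (0 : 'M[R]_(m, 0)), (0 : 'M[R]_(0, 0)); split => //.
  - by apply/matrixP => -[].
  - by apply/matrixP => ? [].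
  - by apply/matrixP => ? [].
pose Y' : 'M[R]_(m, 1 + k) := Y.
have [q [Q [Z [qk QQ YQ QY]]]] := IH (rsubmx Y').
pose y := lsubmx Y'.
have [u uE] : exists u, u = y - Q *m (Q^T *m y) by eexists.
have Qu : Q^T *m u = 0 by rewrite uE mulmxBr (mulmxA Q^T Q) QQ mul1mx subrr.
have [u0|u0] := eqVneq u 0.
  exists q, Q, (col_mx 0 Z : 'M[R]_(1 + k, q)); split => //.
  - exact: leqW.
  - change (Y' = Q *m Q^T *m Y').
    rewrite -[in RHS](hsubmxK Y') mul_mx_row.
    rewrite -YQ -mulmxA; have /eqP := u0; rewrite uE subr_eq0 => /eqP <-.
    by rewrite hsubmxK.
  - change (Q = Y' *m col_mx 0 Z); rewrite -[in RHS](hsubmxK Y').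
    by rewrite mul_row_col mulmx0 add0r.
have nu0 : 0 < nsq u.
  by rewrite lt_neqAle nsq_ge0 andbT eq_sym; apply: contra_neq u0 => /nsq_eq0.
pose c := (Num.sqrt (nsq u))^-1.
have c0 : c != 0 by rewrite invr_neq0// sqrtr_eq0 -ltNge.
have uu : u^T *m u = ((c ^+ 2)^-1)%:M.
  apply/matrixP => i j; rewrite !ord1 mxE -exprVn invrK sqr_sqrtr ?nsq_ge0// mxE.
  rewrite eqxx mulr1n nsqE; apply: eq_bigr => l _.
  by rewrite big_ord1 mxE expr2.
(* Because [Q = rsubmx Y' *m Z], the new column [c *: u] is [c] times [y] minus the combination
   [c *: (Z *m (Q^T *m y))] of the remaining columns; this is the first block column. *)
exists (1 + q)%N, (row_mx (c *: u) Q : 'M[R]_(m, 1 + q)),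
  (block_mx (c%:M) 0 ((- c) *: (Z *m (Q^T *m y))) Z : 'M[R]_(1 + k, 1 + q)).
split.
- by rewrite add1n ltnS.
- have Qcu : Q^T *m (c *: u) = 0 by rewrite -scalemxAr Qu scaler0.
  have cuQ : (c *: u)^T *m Q = 0 by rewrite -[LHS]trmxK trmx_mul trmxK Qcu trmx0.
  rewrite tr_row_mx mul_col_row QQ Qcu cuQ [(c *: u)^T]linearZ/= -scalemxAl -scalemxAr uu.
  rewrite scalerA -expr2 -mul_scalar_mx -scalar_mxM mulfV ?sqrf_eq0//.
  by rewrite -scalar_mx_block.
- have E : row_mx (c *: u) Q *m (row_mx (c *: u) Q)^T = c ^+ 2 *: (u *m u^T) + Q *m Q^T.
    by rewrite tr_row_mx mul_row_col [(c *: u)^T]linearZ/= -scalemxAl -scalemxAr scalerA.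
  change (Y' = row_mx (c *: u) Q *m (row_mx (c *: u) Q)^T *m Y').
  rewrite E -[in RHS](hsubmxK Y') mul_mx_row !mulmxDl -YQ.
  have uQ : u^T *m Q = 0 by rewrite -[u^T *m Q]trmxK trmx_mul trmxK Qu trmx0.
  have uY : u^T *m rsubmx Y' = 0 by rewrite YQ !mulmxA uQ !mul0mx.
  rewrite -!scalemxAl -!(mulmxA u) uY mulmx0 scaler0 add0r.
  have uy : u^T *m y = ((c ^+ 2)^-1)%:M.
    by rewrite -uu -{1}(subrK (Q *m (Q^T *m y)) y) -uE mulmxDr (mulmxA u^T Q) uQ mul0mx addr0.
  rewrite uy mul_mx_scalar scalerA mulfV ?sqrf_eq0// scale1r -mulmxA.
  by rewrite uE subrK hsubmxK.
- change (row_mx (c *: u) Q = Y' *m block_mx c%:M 0 ((- c) *: (Z *m (Q^T *m y))) Z).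
  rewrite -[in RHS](hsubmxK Y') mul_row_block mulmx0 add0r -QY.
  by rewrite mul_mx_scalar -scalemxAr (mulmxA _ Z) -QY scaleNr uE scalerBr.
Qed.

(** Write [B O = Q R'], where [R'] has the right inverse [Z]. Full column rank of [G = P^T Q]
    identifies [R' (G R')^+] with [G^+], so the Nystrom matrix is the oblique projector [Q G^+ P^T].
    It fixes [Q], so the error is [E - Q G^+ P^T E], whose two terms are orthogonal because
    [Q^T E = 0]. *)
Lemma nsq_nystrom_error m n k s q (B : 'M[R]_(m, n)) (O : 'M[R]_(n, k))
    (P : 'M[R]_(m, s)) (Q : 'M[R]_(m, q)) (Z : 'M[R]_(k, q)) :
  Q^T *m Q = 1%:M -> B *m O = Q *m Q^T *m (B *m O) -> Q = B *m O *m Z ->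
  row_full (P^T *m Q) ->
  let E := (1%:M - Q *m Q^T) *m B in
  nsq ((1%:M - nystrom_proj B O P) *m B) =
  nsq E + nsq (moore_penrose (P^T *m Q) *m P^T *m E).
Proof.
move=> QQ YQ QY /row_fullP[L LG] E.
have [Y YE] : exists Y, Y = B *m O by eexists.
have [G GE] : exists G, G = P^T *m Q by eexists.
have [R' RE] : exists R', R' = Q^T *m Y by eexists.
rewrite -GE -YE in LG YQ QY *; set X := moore_penrose (P^T *m Y).
have R'Z : R' *m Z = 1%:M by rewrite RE -mulmxA -QY QQ.
have T : P^T *m Y = G *m R' by rewrite {1}YQ GE RE !mulmxA.
have [TXT _ TXs _] : is_moore_penrose (P^T *m Y) X := moore_penroseP _.
have RXG : R' *m X *m G = 1%:M.
  (* In [G R' X G R' = G R'] the outer factors cancel: [L] on the left of [G], [Z] on the right of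
     [R']. *)
  move: TXT; rewrite T => /(congr1 (fun M => L *m M *m Z)).
  by rewrite !mulmxA LG !mul1mx -!mulmxA R'Z !mulmx1.
have RX : R' *m X = moore_penrose G.
  by apply: moore_penrose_full_col => //; rewrite mulmxA -T.
have GG : moore_penrose G *m G = 1%:M by rewrite -RX.
have -> : nystrom_proj B O P = Q *m moore_penrose G *m P^T.
  by rewrite /nystrom_proj -YE -/X {1}YQ -RX RE !mulmxA.
have QE : Q^T *m E = 0 by rewrite mulmxA mulmxBr mulmx1 mulmxA QQ mul1mx subrr mul0mx.
have -> : (1%:M - Q *m moore_penrose G *m P^T) *m B =
    E - Q *m (moore_penrose G *m P^T *m E).
  have -> : moore_penrose G *m P^T *m E =
      moore_penrose G *m P^T *m B - Q^T *m B.
    rewrite /E mulmxBl mul1mx mulmxBr -(mulmxA Q) [X in _ - X]mulmxA.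
    by rewrite -(mulmxA _ P^T Q) -GE GG mul1mx.
  by rewrite /E !mulmxBl !mul1mx mulmxBr opprB !mulmxA addrA subrK.
rewrite nsqD_orth ?nsqN; first by rewrite (nsq_mul_orth _ QQ).
by rewrite mulmxN (mulmxA E^T Q) -[E^T *m Q]trmxK trmx_mul trmxK QE trmx0 mul0mx oppr0.
Qed.

(** The projector [1 - Q Q^T] annihilates [Y X], so it may be applied to [B - Y X] instead of [B],
    and it does not increase the norm. *)
Lemma nsq_range_residual_le m n k q (B : 'M[R]_(m, n)) (Y : 'M[R]_(m, k))
    (Q : 'M[R]_(m, q)) (X : 'M[R]_(k, n)) :
  Q^T *m Q = 1%:M -> Y = Q *m Q^T *m Y ->
  nsq ((1%:M - Q *m Q^T) *m B) <= nsq (B - Y *m X).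
Proof.
move=> QQ YQ.
have [D DE] : exists D, D = B - Y *m X by eexists.
have EY : (1%:M - Q *m Q^T) *m Y = 0 by rewrite mulmxBl mul1mx -YQ subrr.
have -> : (1%:M - Q *m Q^T) *m B = (1%:M - Q *m Q^T) *m D.
  by rewrite DE mulmxBr (mulmxA _ Y) EY mul0mx subr0.
rewrite -DE -[X in _ <= nsq X](subrK (Q *m (Q^T *m D)) D) nsqD_orth.
  by rewrite mulmxBl mul1mx mulmxA lerDl nsq_ge0.
rewrite (mulmxA _ Q) -[X in X *m _]trmxK trmx_mul trmxK mulmxBr (mulmxA Q^T).
by rewrite QQ mul1mx subrr trmx0 mul0mx.
Qed.

End orthonormal_range.

(** * Spectral theorem and singular values *)

Section spectral.
Context (R : realType).

Lemma nsq_rV n (x : 'rV[R]_n) : nsq x = (x *m x^T) 0 0.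
Proof. by rewrite -nsqT /nsq trmxK /mxtrace big_ord1. Qed.

Lemma continuous_coord_sum n (x : 'rV[R]_n) (F : 'I_n -> 'rV[R]_n -> R) :
  (forall j, continuous (F j)) ->
  {for x, continuous (fun x => \sum_j F j x)}.
Proof.
move=> cF; apply: (@continuous_big _ _ +%R 0 xpredT _ _ _ F) => //.
exact: add_continuous.
Qed.

Lemma continuous_nsq_rV n : continuous (fun x : 'rV[R]_n => nsq x).
Proof.
move=> x; rewrite (_ : (fun x : 'rV[R]_n => nsq x) =
    fun x => \sum_j x 0 j ^+ 2); last first.
  by apply/funext => y; rewrite nsqE big_ord1.
apply: continuous_coord_sum => j y.
apply: (@continuous_comp _ _ _ (fun x : 'rV[R]_n => x 0 j) (fun u => u ^+ 2)).
  exact: coord_continuous.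
exact: exprn_continuous.
Qed.

Lemma continuous_mulmx_entry n p (S : 'M[R]_(n, p)) k :
  continuous (fun x : 'rV[R]_n => (x *m S) 0 k).
Proof.
move=> x; rewrite (_ : (fun x : 'rV[R]_n => (x *m S) 0 k) =
    fun x => \sum_j x 0 j * S j k); last by apply/funext => y; rewrite mxE.
apply: continuous_coord_sum => j y.
apply: continuousM; [exact: coord_continuous|exact: cst_continuous].
Qed.

Lemma continuous_quadratic n (S : 'M[R]_n) :
  continuous (fun x : 'rV[R]_n => (x *m S *m x^T) 0 0).
Proof.
move=> x; rewrite (_ : (fun x : 'rV[R]_n => (x *m S *m x^T) 0 0) =
    fun x => \sum_j (x *m S) 0 j * x 0 j); last first.
  by apply/funext => y; rewrite mxE; apply: eq_bigr => j _; rewrite [_^T _ _]mxE.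
apply: continuous_coord_sum => j y.
by apply: continuousM; [exact: continuous_mulmx_entry|exact: coord_continuous].
Qed.

(* The eigenvector is a maximizer of the Rayleigh quotient on the unit sphere
   of the orthogonal complement of the columns of V. *)
Lemma symmetric_eigenvector n j (S : 'M[R]_n) (V : 'M[R]_(n, j)) (L : 'M[R]_j) :
  S^T = S -> V^T *m V = 1%:M -> S *m V = V *m L -> (j < n)%N ->
  exists (x : 'cV[R]_n) a, [/\ V^T *m x = 0, nsq x = 1 & S *m x = a *: x].
Proof.
move=> ST VV SV jn.
pose A := [set x : 'rV[R]_n | x *m V = 0 /\ nsq x = 1].
have nsq_gt0 (y : 'rV[R]_n) : y != 0 -> 0 < nsq y.
  move=> y0; rewrite lt_neqAle nsq_ge0 andbT eq_sym.
  by apply: contra_neq y0 => /nsq_eq0.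
have normalize (y : 'rV[R]_n) : y != 0 -> y *m V = 0 ->
    A ((Num.sqrt (nsq y))^-1 *: y).
  move=> y0 yV; split; first by rewrite -scalemxAl yV scaler0.
  by rewrite nsqZ exprVn sqr_sqrtr ?nsq_ge0// mulVf// gt_eqF// nsq_gt0.
have A0 : A !=set0.
  have /rowV0Pn[y /sub_kermxP yV y0] : kermx V != 0.
    rewrite -mxrank_eq0 mxrank_ker -lt0n subn_gt0.
    exact: leq_ltn_trans (rank_leq_col _) jn.
  by eexists; exact: normalize y0 yV.
have cA : compact A.
  apply: bounded_closed_compact.
    exists 1; split => // M M1 y [_ y1]; apply: le_trans (ltW M1).
    rewrite [leLHS]/Num.norm /= mx_normrE; apply/bigmax_leP; split => // i _.
    rewrite -(@ler_pXn2r _ 2)// ?nnegrE// expr1n real_normK ?num_real// -y1.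
    exact: sqr_entry_le_nsq.
  have -> : A = \bigcap_(k in [set: 'I_j]) ((fun x => (x *m V) 0 k) @^-1` [set 0])
      `&` ((fun x => nsq x) @^-1` [set 1]).
    apply/seteqP; split => x [xV x1]; split => //=.
      by move=> k _; rewrite /= xV mxE.
    by apply/rowP => k; rewrite [RHS]mxE; exact: xV.
  apply: closedI; first apply: closed_bigI => k _.
    apply: preimage_closed; last exact: closed_eq.
    by move=> x _; exact: continuous_mulmx_entry.
  apply: preimage_closed; last exact: closed_eq.
  by move=> x _; exact: continuous_nsq_rV.
have [x /set_mem[xV x1] xmax] := EVT_max_rV A0 cA
  (continuous_subspaceT (@continuous_quadratic n S)).
set a := (x *m S *m x^T) 0 0 in xmax.
have qle (y : 'rV[R]_n) : y *m V = 0 -> (y *m S *m y^T) 0 0 <= a * nsq y.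
  move=> yV; have [->|y0] := eqVneq y 0.
    by rewrite !mul0mx mxE nsq_rV mul0mx mxE mulr0.
  have := xmax _ (mem_set (normalize _ y0 yV)).
  rewrite [(_ *: y)^T]linearZ/= -!scalemxAl -scalemxAr scalerA mxE -invfM.
  by rewrite -expr2 sqr_sqrtr ?nsq_ge0// mulrC ler_pdivrMr// nsq_gt0.
exists x^T, a; split; first by rewrite -trmx_mul xV trmx0.
  by rewrite nsqT.
suff xS : x *m S = a *: x by rewrite -{1}ST -trmx_mul xS linearZ.
apply/eqP; rewrite -subr_eq0; apply/eqP.
(* The residual of the eigenvalue equation. Invariance [S V = V L] makes [h] orthogonal to the
   columns of [V], so [x + t h] satisfies the constraint for every [t]. *)
have [h hE] : exists h, h = x *m S - a *: x by eexists.
rewrite -hE.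
have hV : h *m V = 0.
  by rewrite hE mulmxBl -mulmxA SV mulmxA xV mul0mx -scalemxAl xV scaler0 subr0.
apply: nsq_eq0; apply/eqP; apply: contraT => h0.
have N0 : 0 < nsq h by rewrite lt_neqAle nsq_ge0 andbT eq_sym.
have mxD (M N : 'M[R]_1) : (M + N) 0 0 = M 0 0 + N 0 0 by rewrite mxE.
have mxZ b (M : 'M[R]_1) : (b *: M) 0 0 = b * M 0 0 by rewrite mxE.
(* The Rayleigh bound at [x + t h]: a nonzero residual would contribute the first-order gain
   [2 t |h|^2]. *)
have key t : 2 * t * nsq h + t ^+ 2 * ((h *m S *m h^T) 0 0 - a * nsq h) <= 0.
  have xtV : (x + t *: h) *m V = 0.
    by rewrite mulmxDl xV -scalemxAl hV scaler0 addr0.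
  have := qle _ xtV.
  have hx : (x *m S *m h^T) 0 0 = nsq h + a * (x *m h^T) 0 0.
    by rewrite -(subrK (a *: x) (x *m S)) -hE mulmxDl -scalemxAl nsq_rV [LHS]mxE [X in _ + X]mxE.
  have xh : (h *m S *m x^T) 0 0 = (x *m S *m h^T) 0 0.
    have <- : ((x *m S *m h^T)^T) 0 0 = (x *m S *m h^T) 0 0 by rewrite mxE.
    by rewrite !trmx_mul trmxK ST mulmxA.
  have xhx : (h *m x^T) 0 0 = (x *m h^T) 0 0.
    have <- : ((x *m h^T)^T) 0 0 = (x *m h^T) 0 0 by rewrite mxE.
    by rewrite trmx_mul trmxK.
  have -> : ((x + t *: h) *m S *m (x + t *: h)^T) 0 0 =
      a + 2 * t * (x *m S *m h^T) 0 0 + t ^+ 2 * (h *m S *m h^T) 0 0.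
    rewrite [(_ + _)^T]linearD/= [(_ *: _)^T]linearZ/= !mulmxDl !mulmxDr -!scalemxAl -!scalemxAr.
    by rewrite !mxD !mxZ xh -/a; ring.
  have -> : nsq (x + t *: h) = 1 + 2 * t * (x *m h^T) 0 0 + t ^+ 2 * nsq h.
    rewrite nsq_rV [(_ + _)^T]linearD/= [(_ *: _)^T]linearZ/= !mulmxDl.
    rewrite !mulmxDr -!scalemxAl -!scalemxAr.
    by rewrite !mxD !mxZ -!nsq_rV x1 xhx; ring.
  rewrite hx; lra.
have c0 : (h *m S *m h^T) 0 0 - a * nsq h <= 0 by rewrite subr_le0 qle.
set c := (_ - _) in key c0; set N := nsq h in key N0.
have cN0 : 0 < N - c by lra.
(* The vertex [- N / c] of the parabola is lost when [c = 0]; this value of [t] gives a positive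
   left-hand side for every [c <= 0]. *)
have := key (N / (N - c)).
have -> : 2 * (N / (N - c)) * N + (N / (N - c)) ^+ 2 * c =
  (N / (N - c)) ^+ 2 * (2 * N - c) by field; rewrite gt_eqF.
rewrite leNgt mulr_gt0 ?exprn_gt0 ?divr_gt0//; lra.
Qed.

(** Orthonormal eigenvectors are collected one at a time, by induction on their number [j] up to
    [n]. *)
Lemma spectral_symmetric n (S : 'M[R]_n) : S^T = S ->
  exists (V : 'M[R]_n) (d : 'rV[R]_n), V^T *m V = 1%:M /\ S *m V = V *m diag_mx d.
Proof.
move=> ST.
suff : forall j, (j <= n)%N -> exists (V : 'M[R]_(n, j)) (d : 'rV[R]_j),
  V^T *m V = 1%:M /\ S *m V = V *m diag_mx d by apply.
elim=> [_|j IH jn].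
  exists 0, 0; split; first by apply/matrixP => -[].
  by apply/matrixP => ? [].
have [V [d [VV SV]]] := IH (ltnW jn).
have [x [a [Vx x1 Sx]]] := symmetric_eigenvector ST VV SV jn.
exists (row_mx x V : 'M[R]_(n, 1 + j)), (row_mx a%:M d : 'rV[R]_(1 + j)); split.
  have xV : x^T *m V = 0 by rewrite -[LHS]trmxK trmx_mul trmxK Vx trmx0.
  have xx : x^T *m x = 1%:M.
    apply/matrixP => i k; rewrite !ord1.
    by have := x1; rewrite /nsq /mxtrace big_ord1 => ->; rewrite mxE.
  change ((row_mx x V)^T *m row_mx x V = (1%:M : 'M[R]_(1 + j))).
  by rewrite tr_row_mx mul_col_row VV Vx xV xx -scalar_mx_block.
change (S *m row_mx x V = row_mx x V *m diag_mx (row_mx a%:M d)).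
rewrite mul_mx_row Sx SV diag_mx_row mul_row_block !mulmx0 addr0 add0r.
congr row_mx; rewrite (_ : diag_mx _ = a%:M) ?mul_mx_scalar//.
by apply/matrixP => i k; rewrite !ord1 !mxE.
Qed.

End spectral.

Section eigenvalue_list.
Context (R : realType).

(** The similarity is lifted to characteristic matrices over polynomials, where the determinant of
    the lifted [V] is nonzero and cancels. *)
Lemma char_poly_orthogonal_diag n (S V : 'M[R]_n) (d : 'rV[R]_n) :
  V^T *m V = 1%:M -> S *m V = V *m diag_mx d ->
  char_poly S = \prod_(i < n) ('X - (d 0 i)%:P).
Proof.
move=> VV SV; pose V' := map_mx (@polyC R) V.
have V'0 : \det V' != 0.
  have : \det V'^T * \det V' = 1 by rewrite -det_mulmx /V' map_trmx -map_mxM VV map_mx1 det1.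
  by move/eqP; apply: contraTneq => ->; rewrite mulr0 eq_sym oner_eq0.
have h : char_poly_mx S *m V' = V' *m char_poly_mx (diag_mx d).
  by rewrite /char_poly_mx mulmxBl mulmxBr -!map_mxM SV mul_scalar_mx mul_mx_scalar.
have /(congr1 determinant) := h; rewrite !det_mulmx mulrC => /(mulfI V'0).
rewrite -/(char_poly S) => ->; rewrite -/(char_poly _) char_poly_trig ?diag_mx_is_trig//.
by apply: eq_bigr => i _; rewrite mxE eqxx.
Qed.

Lemma mup_prod_XsubC (s : seq R) x :
  mup x (\prod_(a <- s) ('X - a%:P)) = count_mem x s.
Proof.
elim: s => [|a s IH]; first by rewrite big_nil mupNroot ?rootC ?oner_eq0.
rewrite big_cons mupM ?polyXsubC_eq0 ?monic_neq0 ?monic_prod_XsubC// IH/=.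
by have /= := mup_XsubCX 1 x a; rewrite expr1 => ->; case: eqP.
Qed.

Lemma count_flatten_nseq (T : eqType) (c : T -> nat) (s : seq T) x : uniq s ->
  count_mem x (flatten [seq nseq (c y) y | y <- s]) = if x \in s then c x else 0%N.
Proof.
elim: s => //= y s IH /andP[ys us]; rewrite count_cat IH// count_nseq/= inE.
have [->|] := eqVneq x y; first by rewrite (negPf ys) addn0 mul1n.
by [].
Qed.

Lemma sorted_flatten_nseq (c : R -> nat) (s : seq R) : sorted >%R s ->
  sorted >=%R (flatten [seq nseq (c y) y | y <- s]).
Proof.
rewrite !sorted_pairwise; [|exact: rev_trans le_trans|exact: rev_trans lt_trans].
elim: s => //= y s IH /andP[ys ss]; rewrite pairwise_cat IH// andbT; apply/andP; split.
  apply/allrelP => u v /nseqP[-> _] /flattenP[_ /mapP[w ws ->] /nseqP[-> _]].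
  by have /allP/(_ _ ws)/ltW := ys.
by elim: (c y) => //= k ->; rewrite andbT all_nseq /= lexx orbT.
Qed.

Lemma sorted_eigenvalues n (S : 'M[R]_n) : sorted >=%R (eigenvalues S).
Proof. by apply: sorted_flatten_nseq; rewrite rev_sorted; exact: sorted_roots. Qed.

(** The characteristic polynomial splits over the reals, so its real roots with multiplicity exhaust
    the diagonal [d]; both lists count each [x] by its multiplicity. *)
Lemma perm_eigenvalues n (S V : 'M[R]_n) (d : 'rV[R]_n) :
  V^T *m V = 1%:M -> S *m V = V *m diag_mx d ->
  perm_eq (eigenvalues S) [seq d 0 i | i <- enum 'I_n].
Proof.
move=> VV SV; have E : char_poly S = \prod_(a <- [seq d 0 i | i <- enum 'I_n]) ('X - a%:P).
  by rewrite (char_poly_orthogonal_diag VV SV) big_map enumT.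
apply/allP => x _ /=; apply/eqP.
rewrite /eigenvalues count_flatten_nseq ?rev_uniq ?uniq_roots// mem_rev.
have p0 : char_poly S != 0 by rewrite monic_neq0// char_poly_monic.
have := roots_on_rootsR p0 x; rewrite in_itv/= => <-; rewrite {2}E mup_prod_XsubC.
case: ifPn => // rx; apply/esym/count_memPn; apply: contra rx => xd.
by rewrite E root_prod_XsubC.
Qed.

Lemma sorted_eigenbasis n (S : 'M[R]_n) : S^T = S ->
  exists V : 'M[R]_n, V^T *m V = 1%:M /\
    S *m V = V *m diag_mx (\row_i (eigenvalues S)`_i).
Proof.
move=> ST; have [V [d [VV SV]]] := spectral_symmetric ST.
have pe := perm_eigenvalues VV SV.
have sz : size (eigenvalues S) == n by rewrite (perm_size pe) size_map size_enum_ord.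
have /tuple_permP[s sE] : perm_eq (Tuple sz) [tuple of [seq d 0 i | i <- ord_tuple n]] by [].
have eE (i : 'I_n) : (eigenvalues S)`_i = d 0 (s i).
  rewrite -[eigenvalues S]/(tval (Tuple sz)) sE -tnth_nth tnth_mktuple.
  by rewrite tnth_map tnth_ord_tuple.
exists (colsub s V); split.
  apply/matrixP => i j; rewrite mxE; under eq_bigr do rewrite !mxE.
  have /matrixP/(_ (s i) (s j)) := VV; rewrite !mxE (inj_eq perm_inj) => <-.
  by apply: eq_bigr => k _; rewrite mxE.
rewrite mulmx_colsub SV !mul_mx_diag.
by apply/matrixP => i j; rewrite !mxE eE.
Qed.

End eigenvalue_list.

(** [V] consists of the leading columns of a sorted eigenbasis of [B^T B]. The residual is then a
    trace minus a partial trace, which is the tail of the eigenvalue sum. *)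
Lemma top_right_singular_vectors (R : realType) m n (B : 'M[R]_(m, n)) r :
  exists q (V : 'M[R]_(n, q)) (L : 'M[R]_q),
    [/\ (q <= r)%N, V^T *m V = 1%:M, B^T *m B *m V = V *m L &
      nsq ((1%:M - V *m V^T) *m B^T) <=
      \sum_(r <= j < minn m n) (singular_values B)`_j ^+ 2].
Proof.
have [S SE] : exists S, S = B^T *m B by eexists.
have ST : S^T = S by rewrite SE trmx_mul trmxK.
have [U [UU SU]] := sorted_eigenbasis ST.
have pe := perm_eigenvalues UU SU.
have sz : size (eigenvalues S) = n by rewrite (perm_size pe) size_map size_enum_ord.
set e := eigenvalues S in SU pe sz.
have cols q (qn : (q <= n)%N) : let V := colsub (widen_ord qn) U in
    [/\ V^T *m V = 1%:M, S *m V = V *m diag_mx (\row_(i < q) e`_i) &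
        (B *m V)^T *m (B *m V) = diag_mx (\row_(i < q) e`_i)].
  move=> V; have VV : V^T *m V = 1%:M.
    apply/matrixP => i j; rewrite mxE; under eq_bigr do rewrite !mxE.
    have /matrixP/(_ (widen_ord qn i) (widen_ord qn j)) := UU; rewrite !mxE => h.
    by rewrite -(_ : widen_ord qn i == widen_ord qn j = (i == j))// -h;
      apply: eq_bigr => k _; rewrite mxE.
  have SV : S *m V = V *m diag_mx (\row_(i < q) e`_i).
    rewrite mulmx_colsub SU !mul_mx_diag.
    by apply/matrixP => i j; rewrite !mxE.
  by split => //; rewrite trmx_mul mulmxA -(mulmxA V^T) -SE -mulmxA SV mulmxA VV mul1mx.
have e_ge0 j : 0 <= e`_j.
  have [jn|nj] := ltnP j n; last by rewrite nth_default ?sz.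
  have [_ _ /matrixP/(_ (Ordinal jn) (Ordinal jn))] := cols n (leqnn n).
  rewrite !mxE eqxx mulr1n => <-; apply: sumr_ge0 => k _.
  by rewrite [_^T _ _]mxE -expr2 sqr_ge0.
(* If [e_j] were positive, the Gram matrix of [B] times the first [j + 1] eigenvectors would be
   invertible of size [j + 1 > m], although its rank is at most [m]. *)
have e_eq0 j : (m <= j)%N -> e`_j = 0.
  move=> mj; have [jn|nj] := ltnP j n; last by rewrite nth_default ?sz.
  apply/eqP; rewrite eq_le e_ge0 andbT leNgt; apply/negP => ej0.
  have [_ _ D] := cols j.+1 jn.
  have : diag_mx (\row_(i < j.+1) e`_i) \in unitmx.
    rewrite unitmxE unitfE det_diag; apply/prodf_neq0 => i _; rewrite mxE gt_eqF//.
    apply: (lt_le_trans ej0).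
    have := sorted_leq_nth (rev_trans le_trans) (@lexx _ R) 0 (sorted_eigenvalues S).
    by apply; rewrite ?inE ?sz// ?(leq_trans (ltn_ord i))// -ltnS.
  rewrite -row_free_unit /row_free -D => /eqP rk.
  have := leq_trans (mxrankM_maxr (B *m colsub (widen_ord jn) U)^T
    (B *m colsub (widen_ord jn) U)) (rank_leq_row _).
  by rewrite rk ltnNge mj.
have sv j : (singular_values B)`_j ^+ 2 = e`_j.
  rewrite /singular_values -SE -/e.
  have [jn|nj] := ltnP j n; last by rewrite !nth_default ?size_map ?sz// expr0n.
  by rewrite (nth_map 0) ?sz// sqr_sqrtr.
have qn : (minn r n <= n)%N := geq_minr r n.
have [VV SV BV] := cols _ qn; set V := colsub _ U in VV SV BV.
(* At most [n] columns are available, and [r] may exceed [n]; in that case the tail is empty. *)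
exists (minn r n), V, (diag_mx (\row_(i < minn r n) e`_i)); split => //.
- exact: geq_minl.
- by rewrite -SE.
have -> : nsq ((1%:M - V *m V^T) *m B^T) = \tr S - \tr (V^T *m S *m V).
  have PP : (1%:M - V *m V^T)^T *m (1%:M - V *m V^T) = 1%:M - V *m V^T.
    rewrite [(_ - _)^T]linearB/= trmx1 trmx_mul trmxK mulmxBl mul1mx mulmxBr mulmx1.
    by rewrite -(mulmxA V) (mulmxA V^T) VV mul1mx subrr subr0.
  rewrite /nsq trmx_mul trmxK -(mulmxA B) (mulmxA _^T) PP mulmxA mulmxBr mulmx1.
  rewrite mulmxBl [\tr (_ - _)]linearB/= mxtrace_mulC -SE; congr (_ - _).
  by rewrite SE !mulmxA mxtrace_mulC !mulmxA mxtrace_mulC !mulmxA.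
have -> : \tr S = \sum_(0 <= i < n) e`_i.
  have -> : S = U *m (diag_mx (\row_i e`_i) *m U^T).
    by rewrite mulmxA -SU -mulmxA (mulmx1C UU) mulmx1.
  rewrite mxtrace_mulC -mulmxA UU mulmx1 mxtrace_diag big_mkord.
  by apply: eq_bigr => i _; rewrite mxE.
have -> : \tr (V^T *m S *m V) = \sum_(0 <= i < minn r n) e`_i.
  rewrite -mulmxA SV mulmxA VV mul1mx mxtrace_diag big_mkord.
  by apply: eq_bigr => i _; rewrite mxE.
rewrite (big_cat_nat _ qn)//= addrAC subrr add0r.
under [leRHS]eq_bigr do rewrite sv.
(* The sum computed stops at [n], the stated one at [minn m n]; they agree because the eigenvalues
   of index at least [m] vanish. *)
have [rn|nr] := leqP r n; last by rewrite big_geq ?sumr_ge0.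
have [mn|nm] := leqP m n; last by [].
have [rm|mr] := leqP r m.
  rewrite (big_cat_nat _ mn)//= gerDl.
  by rewrite big_nat_cond big1// => i /andP[/andP[mi _] _]; exact: e_eq0.
rewrite [leRHS]big_geq ?(ltnW mr)// big_nat_cond big1// => i /andP[/andP[ri _] _].
by rewrite e_eq0// (leq_trans (ltnW mr)).
Qed.

(** * Differentiation of matrix functions *)

Section matrix_calculus.
Context (R : realType) (a b : nat).
Implicit Types (X D : 'M[R]_(a, b)).

Definition mx_deriv p q D (f f' : 'M[R]_(a, b) -> 'M[R]_(p, q)) :=
  forall X i j, is_derive X D (fun Y => f Y i j) (f' X i j).

Definition mx_derivable p q (f : 'M[R]_(a, b) -> 'M[R]_(p, q)) :=
  forall D X i j, derivable (fun Y => f Y i j) X D.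

Lemma mx_deriv_derivable p q D (f f' : 'M[R]_(a, b) -> 'M[R]_(p, q)) X i j :
  mx_deriv D f f' -> derivable (fun Y => f Y i j) X D.
Proof. by move=> df; have [] := df X i j. Qed.

Lemma is_derive_bigsum (I : Type) (s : seq I) (h dh : I -> 'M[R]_(a, b) -> R) X D :
  (forall i, is_derive X D (h i) (dh i X)) ->
  is_derive X D (fun Y => \sum_(i <- s) h i Y) (\sum_(i <- s) dh i X).
Proof.
move=> hd; elim: s => [|i s IH].
  rewrite big_nil (_ : (fun _ => _) = cst 0); first exact: is_derive_cst.
  by apply/funext => Y; rewrite big_nil.
rewrite big_cons (_ : (fun _ => _) = h i + fun Y => \sum_(i <- s) h i Y).
  exact: is_deriveD.
by apply/funext => Y; rewrite big_cons.
Qed.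

Lemma derivable_bigsum (I : Type) (s : seq I) (h : I -> 'M[R]_(a, b) -> R) X D :
  (forall i, derivable (h i) X D) -> derivable (fun Y => \sum_(i <- s) h i Y) X D.
Proof.
move=> hd; suff [] : is_derive X D (fun Y => \sum_(i <- s) h i Y)
  (\sum_(i <- s) 'D_D (h i) X) by [].
by apply: (@is_derive_bigsum _ s h (fun i Y => 'D_D (h i) Y)) => i; exact: derivableP.
Qed.

Lemma derivable_bigprod (I : Type) (s : seq I) (h : I -> 'M[R]_(a, b) -> R) X D :
  (forall i, derivable (h i) X D) -> derivable (fun Y => \prod_(i <- s) h i Y) X D.
Proof.
move=> hd; elim: s => [|i s IH].
  rewrite (_ : (fun _ => _) = cst 1); first exact: derivable_cst.
  by apply/funext => Y; rewrite big_nil.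
rewrite (_ : (fun _ => _) = h i * fun Y => \prod_(i <- s) h i Y).
  exact: derivableM.
by apply/funext => Y; rewrite big_cons.
Qed.

Lemma mx_deriv_cst p q D (C : 'M[R]_(p, q)) : mx_deriv D (fun=> C) (fun=> 0).
Proof. by move=> X i j; rewrite mxE; exact: is_derive_cst. Qed.

Lemma is_derive_entry D X i j : is_derive X D (fun Y => Y i j) (D i j).
Proof.
have dI : derivable (id : 'M[R]_(a, b) -> 'M[R]_(a, b)) X D by exact: derivable_id.
have dE := iffLR (derivable_mxP _ _ _) dI; apply: DeriveDef; first exact: dE i j.
by have := derive_mx dI; rewrite derive_id => /matrixP/(_ i j); rewrite mxE.
Qed.

Lemma mx_deriv_id D : mx_deriv D id (fun=> D).
Proof. by move=> X i j; exact: is_derive_entry. Qed.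

Lemma mx_deriv_tr p q D (f f' : 'M[R]_(a, b) -> 'M[R]_(p, q)) :
  mx_deriv D f f' -> mx_deriv D (fun X => (f X)^T) (fun X => (f' X)^T).
Proof.
move=> df X i j; rewrite mxE (_ : (fun _ => _) = fun Y => f Y j i)//.
by apply/funext => Y; rewrite mxE.
Qed.

Lemma mx_derivD p q D (f f' g g' : 'M[R]_(a, b) -> 'M[R]_(p, q)) :
  mx_deriv D f f' -> mx_deriv D g g' ->
  mx_deriv D (fun X => f X + g X) (fun X => f' X + g' X).
Proof.
move=> df dg X i j; rewrite mxE.
rewrite (_ : (fun _ => _) = (fun Y => f Y i j) + (fun Y => g Y i j)).
  exact: is_deriveD.
by apply/funext => Y; rewrite mxE.
Qed.

Lemma mx_derivM p q r D (f f' : 'M[R]_(a, b) -> 'M[R]_(p, q))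
    (g g' : 'M[R]_(a, b) -> 'M[R]_(q, r)) :
  mx_deriv D f f' -> mx_deriv D g g' ->
  mx_deriv D (fun X => f X *m g X) (fun X => f' X *m g X + f X *m g' X).
Proof.
move=> df dg X i j; rewrite !mxE -big_split/=.
rewrite (_ : (fun _ => _) = fun Y => \sum_k f Y i k * g Y k j); last first.
  by apply/funext => Y; rewrite mxE.
apply: (@is_derive_bigsum _ _ (fun k Y => f Y i k * g Y k j)
  (fun k X => f' X i k * g X k j + f X i k * g' X k j)) => k.
have := is_deriveM (df X i k) (dg X k j).
by rewrite addrC /GRing.scale/= [g X k j * _]mulrC.
Qed.

Lemma mx_derivable_det p (f : 'M[R]_(a, b) -> 'M[R]_p) D X :
  (forall i j, derivable (fun Y => f Y i j) X D) ->
  derivable (fun Y => \det (f Y)) X D.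
Proof.
move=> df; apply: derivable_bigsum => s; apply: derivableM.
  exact: derivable_cst.
by apply: derivable_bigprod => i.
Qed.

(** By Cramer's rule the entries of the inverse are cofactors divided by the determinant, that is,
    polynomials in the entries over a nonvanishing polynomial. *)
Lemma mx_derivable_inv p (f : 'M[R]_(a, b) -> 'M[R]_p) D X i j :
  (forall Y, f Y \in unitmx) -> (forall i j, derivable (fun Y => f Y i j) X D) ->
  derivable (fun Y => invmx (f Y) i j) X D.
Proof.
move=> uf df.
rewrite (_ : (fun _ => _) = (fun Y => (\det (f Y))^-1) * (fun Y => cofactor (f Y) j i)); last first.
  by apply/funext => Y; rewrite /invmx uf !mxE.
apply: derivableM.
  by apply: derivableV; [rewrite -unitfE -unitmxE|exact: mx_derivable_det].
apply: derivableM; first exact: derivable_cst.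
apply: mx_derivable_det => k l.
by rewrite (_ : (fun _ => _) = fun Y => f Y (lift j k) (lift i l))//;
  apply/funext => Y; rewrite !mxE.
Qed.

(** Differentiability is already known, so the formula follows by differentiating
    [f X *m invmx (f X) = 1] and solving. *)
Lemma mx_deriv_inv p D (f f' : 'M[R]_(a, b) -> 'M[R]_p) :
  (forall X, f X \in unitmx) -> mx_deriv D f f' ->
  mx_deriv D (fun X => invmx (f X))
    (fun X => - (invmx (f X) *m f' X *m invmx (f X))).
Proof.
move=> uf df.
pose g' X := \matrix_(i, j) 'D_D (fun Y => invmx (f Y) i j) X.
have dg : mx_deriv D (fun X => invmx (f X)) g'.
  move=> X i j; rewrite mxE; apply: derivableP.
  by apply: mx_derivable_inv => // k l; exact: mx_deriv_derivable.
move=> X i j; have -> : - (invmx (f X) *m f' X *m invmx (f X)) = g' X; last exact: dg.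
have h : f' X *m invmx (f X) + f X *m g' X = 0.
  apply/matrixP => k l.
  have [_ <-] := mx_derivM df dg X k l.
  rewrite (_ : (fun _ => _) = cst ((1%:M : 'M[R]_p) k l)); first by rewrite derive_cst mxE.
  by apply/funext => Y; rewrite mulmxV ?uf.
move/(congr1 (mulmx (invmx (f X)))): h.
rewrite mulmxDr mulmx0 !mulmxA mulVmx// mul1mx => /eqP.
by rewrite addr_eq0 => /eqP ->; rewrite opprK.
Qed.

End matrix_calculus.

Section matrix_measurability.
Context (R : realType) (dT : measure_display) (T : measurableType dT).

Definition mx_meas p q (f : T -> 'M[R]_(p, q)) :=
  forall i j, measurable_fun setT (fun w => f w i j).

Lemma mx_meas_cst p q (C : 'M[R]_(p, q)) : mx_meas (fun=> C).
Proof. by move=> i j; exact: measurable_cst. Qed.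

Lemma mx_meas_tr p q (f : T -> 'M[R]_(p, q)) :
  mx_meas f -> mx_meas (fun w => (f w)^T).
Proof. by move=> mf i j; under eq_fun do rewrite mxE; exact: mf. Qed.

Lemma mx_measD p q (f g : T -> 'M[R]_(p, q)) :
  mx_meas f -> mx_meas g -> mx_meas (fun w => f w + g w).
Proof.
by move=> mf mg i j; under eq_fun do rewrite mxE; exact: measurable_funD.
Qed.

Lemma mx_measN p q (f : T -> 'M[R]_(p, q)) :
  mx_meas f -> mx_meas (fun w => - f w).
Proof.
move=> mf i j; under eq_fun do rewrite mxE.
exact: measurable_funN.
Qed.

Lemma mx_measM p q r (f : T -> 'M[R]_(p, q)) (g : T -> 'M[R]_(q, r)) :
  mx_meas f -> mx_meas g -> mx_meas (fun w => f w *m g w).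
Proof.
move=> mf mg i j; under eq_fun do rewrite mxE.
by apply: measurable_sum => k; exact: measurable_funM.
Qed.

Lemma measurable_det p (f : T -> 'M[R]_p) :
  mx_meas f -> measurable_fun setT (fun w => \det (f w)).
Proof.
move=> mf; apply: measurable_sum => s; apply: measurable_funM => //.
by apply: measurable_prod => i _.
Qed.

Lemma measurable_trace p (f : T -> 'M[R]_p) :
  mx_meas f -> measurable_fun setT (fun w => \tr (f w)).
Proof. by move=> mf; apply: measurable_sum => i. Qed.

Lemma measurable_nsq p q (f : T -> 'M[R]_(p, q)) :
  mx_meas f -> measurable_fun setT (fun w => nsq (f w)).
Proof. by move=> mf; apply: measurable_trace; apply: mx_measM => //; exact: mx_meas_tr. Qed.

Lemma mx_meas_inv p (f : T -> 'M[R]_p) : (forall w, f w \in unitmx) ->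
  mx_meas f -> mx_meas (fun w => invmx (f w)).
Proof.
move=> uf mf i j; under eq_fun do rewrite /invmx uf !mxE.
apply: measurable_funM; last first.
  apply: measurable_funM => //; apply: measurable_det => k l.
  by under eq_fun do rewrite !mxE; exact: mf.
(* Scalar inversion is continuous away from 0 only, so it is composed on the open set of nonzero
   reals, which contains all the determinants. *)
apply: (@measurable_comp _ _ _ _ _ _ [set x : R | x != 0] (@GRing.inv R)).
- by apply: open_measurable; exact: open_neq.
- by move=> _ [w _ <-] /=; rewrite -unitfE -unitmxE.
- apply: open_continuous_measurable_fun; first exact: open_neq.
  by move=> x /set_mem /= x0; exact: inv_continuous.
- exact: measurable_det.
Qed.

Lemma mx_meas_resolvent e p q (f : T -> 'M[R]_(p, q)) : 0 < e ->
  mx_meas f -> mx_meas (fun w => resolvent e (f w)).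
Proof.
move=> e0 mf; apply: mx_meas_inv => [w|]; first exact: regularized_gram_unitmx.
apply: mx_measD; last exact: mx_meas_cst.
by apply: mx_measM => //; exact: mx_meas_tr.
Qed.

End matrix_measurability.

Section tame.
Context (R : realType) (a b : nat).
Implicit Types X : 'M[R]_(a, b).

(** The summand 1 makes powers increase with the exponent, so that growth degrees may be raised. *)
Definition mx_size X : R := 1 + \sum_i \sum_j `|X i j|.

Lemma mx_size_ge1 X : 1 <= mx_size X.
Proof. by rewrite lerDl; apply: sumr_ge0 => i _; exact: sumr_ge0. Qed.

Lemma mx_size_gt0 X : 0 < mx_size X.
Proof. exact: lt_le_trans (mx_size_ge1 X). Qed.

Lemma entry_le_mx_size X i j : `|X i j| <= mx_size X.
Proof.
rewrite /mx_size (bigD1 i)//= (bigD1 j)//= addrCA -addrA lerDl.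
rewrite addr_ge0 ?addr_ge0 ?sumr_ge0// => k _; exact: sumr_ge0.
Qed.

(* Growth of degree at most k, with the regularity that Gaussian integration by
   parts needs. *)
Definition tame (k : nat) p q (f : 'M[R]_(a, b) -> 'M[R]_(p, q)) :=
  [/\ exists2 K, 0 <= K & forall X i j, `|f X i j| <= K * mx_size X ^+ k,
      mx_meas f & mx_derivable f].

Lemma tame_cst p q (C : 'M[R]_(p, q)) : tame 0 (fun=> C).
Proof.
split; first 1 last.
- exact: mx_meas_cst.
- by move=> D X i j; exact: derivable_cst.
exists (\sum_i \sum_j `|C i j|).
  by apply: sumr_ge0 => i _; exact: sumr_ge0.
move=> X i j; rewrite expr0 mulr1 (bigD1 i)//= (bigD1 j)//= -addrA lerDl addr_ge0//.
  exact: sumr_ge0.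
by apply: sumr_ge0 => k _; exact: sumr_ge0.
Qed.

Lemma tame_id : tame 1 (@id 'M[R]_(a, b)).
Proof.
split; first by exists 1 => // X i j; rewrite mul1r expr1 entry_le_mx_size.
  by move=> i j; exact: measurable_mx_entry.
by move=> D X i j; apply: mx_deriv_derivable; exact: mx_deriv_id.
Qed.

Lemma tame_tr k p q (f : 'M[R]_(a, b) -> 'M[R]_(p, q)) :
  tame k f -> tame k (fun X => (f X)^T).
Proof.
move=> [[K K0 bf] mf df]; split.
- by exists K => // X i j; rewrite mxE.
- exact: mx_meas_tr.
- by move=> D X i j; under eq_fun do rewrite mxE; exact: df.
Qed.

Lemma tame_leq k l p q (f : 'M[R]_(a, b) -> 'M[R]_(p, q)) :
  (k <= l)%N -> tame k f -> tame l f.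
Proof.
move=> kl [[K K0 bf] mf df]; split => //; exists K => // X i j.
by apply: (le_trans (bf X i j)); rewrite ler_wpM2l// ler_weXn2l// mx_size_ge1.
Qed.

Lemma tameD k p q (f g : 'M[R]_(a, b) -> 'M[R]_(p, q)) :
  tame k f -> tame k g -> tame k (fun X => f X + g X).
Proof.
move=> [[K K0 bf] mf df] [[L L0 bg] mg dg]; split.
- exists (K + L); first exact: addr_ge0.
  by move=> X i j; rewrite mxE mulrDl (le_trans (ler_normD _ _))// lerD.
- exact: mx_measD.
- by move=> D X i j; under eq_fun do rewrite mxE; exact: derivableD.
Qed.

Lemma tameN k p q (f : 'M[R]_(a, b) -> 'M[R]_(p, q)) :
  tame k f -> tame k (fun X => - f X).
Proof.
move=> [[K K0 bf] mf df]; split.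
- by exists K => // X i j; rewrite mxE normrN.
- exact: mx_measN.
- by move=> D X i j; under eq_fun do rewrite mxE; exact: derivableN.
Qed.

Lemma mx_derivableM p q r (f : 'M[R]_(a, b) -> 'M[R]_(p, q))
    (g : 'M[R]_(a, b) -> 'M[R]_(q, r)) :
  mx_derivable f -> mx_derivable g -> mx_derivable (fun X => f X *m g X).
Proof.
move=> df dg D X i j; under eq_fun do rewrite mxE.
by apply: derivable_bigsum => k; exact: derivableM.
Qed.

Lemma tameM k l p q r (f : 'M[R]_(a, b) -> 'M[R]_(p, q))
    (g : 'M[R]_(a, b) -> 'M[R]_(q, r)) :
  tame k f -> tame l g -> tame (k + l) (fun X => f X *m g X).
Proof.
move=> [[K K0 bf] mf df] [[L L0 bg] mg dg]; split.
- exists (q%:R * (K * L)); first by rewrite !mulr_ge0.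
  move=> X i j; rewrite mxE (le_trans (ler_norm_sum _ _ _))//.
  apply: (@le_trans _ _ (\sum_(m < q) (K * L) * mx_size X ^+ (k + l))).
    apply: ler_sum => m _; rewrite normrM exprD mulrACA.
    by apply: ler_pM.
  by rewrite sumr_const card_ord -[leRHS]mulrA mulr_natl lexx.
- exact: mx_measM.
- exact: mx_derivableM.
Qed.

Section resolvent_tame.
Context (q : nat) (Q : 'M[R]_(a, q)) (e : R).
Hypothesis e0 : 0 < e.
Local Notation G := (fun X => X^T *m Q).
Local Notation M := (fun X => resolvent e (X^T *m Q)).
Local Notation W := (fun X => X^T *m Q *m resolvent e (X^T *m Q)).

Lemma tame_trid : tame 1 (fun X => X^T).
Proof. exact: tame_tr tame_id. Qed.

Lemma tame_gram_arg : tame 1 G.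
Proof. by rewrite -[1%N]addn0; apply: tameM; [exact: tame_trid|exact: tame_cst]. Qed.

Lemma tame_resolvent : tame 0 M.
Proof.
have [_ mG dG] := tame_gram_arg.
split.
- by exists e^-1; [rewrite invr_ge0 ltW|move=> X i j; rewrite expr0 mulr1 norm_resolvent_le].
- exact: mx_meas_resolvent.
- move=> D X i j; apply: mx_derivable_inv => [Y|k l].
    exact: regularized_gram_unitmx.
  have [_ _ dN] : tame 2 (fun X => (X^T *m Q)^T *m (X^T *m Q) + e%:M).
    apply: tameD; last by apply: tame_leq (tame_cst _).
    rewrite -[2%N]/(1 + 1)%N; apply: tameM; last exact: tame_gram_arg.
    by apply: tame_tr; exact: tame_gram_arg.
  exact: dN.
Qed.

(** The product rule alone would give degree 1. Boundedness of [G M] gives degree 0, which keeps the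
    fields below at degree 1 and their products with [X] at degree 2. *)
Lemma tame_gram_resolvent : tame 0 W.
Proof.
have [_ mW dGW] : tame (1 + 0) W.
  by apply: tameM; [exact: tame_gram_arg|exact: tame_resolvent].
split => //; exists (1 + e^-1); first by rewrite addr_ge0// invr_ge0 ltW.
move=> X i j; rewrite expr0 mulr1.
have h := @sqr_mul_resolvent_le _ _ _ e (X^T *m Q) e0 i j.
have e1 : 0 <= e^-1 by rewrite invr_ge0 ltW.
rewrite -(@ler_pXn2r _ 2)// ?nnegrE// ?addr_ge0// real_normK ?num_real//.
apply: (le_trans h); nra.
Qed.

Definition dresolvent (D X : 'M[R]_(a, b)) : 'M[R]_q := - (resolvent e (X^T *m Q) *m
  (Q^T *m D *m (X^T *m Q) + (X^T *m Q)^T *m (D^T *m Q)) *m resolvent e (X^T *m Q)).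

Definition dgram_resolvent (D X : 'M[R]_(a, b)) : 'M[R]_(b, q) :=
  D^T *m Q *m resolvent e (X^T *m Q) + X^T *m Q *m dresolvent D X.

Lemma mx_deriv_gram_arg p D (C : 'M[R]_(a, p)) :
  mx_deriv D (fun X => X^T *m C) (fun=> D^T *m C).
Proof.
move=> X i j; have := mx_derivM (mx_deriv_tr (mx_deriv_id D)) (mx_deriv_cst D C) X i j.
by rewrite mulmx0 addr0.
Qed.

Lemma mx_deriv_resolvent D : mx_deriv D M (dresolvent D).
Proof.
have dN : mx_deriv D (fun X => (X^T *m Q)^T *m (X^T *m Q) + e%:M)
    (fun X => Q^T *m D *m (X^T *m Q) + (X^T *m Q)^T *m (D^T *m Q)).
  move=> X i j; have := mx_derivD (mx_derivM (mx_deriv_tr (@mx_deriv_gram_arg _ D Q))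
    (@mx_deriv_gram_arg _ D Q)) (mx_deriv_cst D e%:M) X i j.
  by rewrite addr0 [(D^T *m Q)^T]trmx_mul trmxK.
by apply: mx_deriv_inv dN => X; exact: regularized_gram_unitmx.
Qed.

Lemma mx_deriv_gram_resolvent D : mx_deriv D W (dgram_resolvent D).
Proof. exact: mx_derivM (@mx_deriv_gram_arg _ D Q) (mx_deriv_resolvent D). Qed.

(** Regrouping [G] with the first resolvent factor as [W], of degree 0, leaves only the derivative
    of the Gram matrix to contribute to the degree. *)
Lemma tame_dW D : tame 1 (dgram_resolvent D).
Proof.
apply: tameD.
  by apply: tame_leq (tameM (tame_cst _) tame_resolvent).
have E X : X^T *m Q *m dresolvent D X = - (X^T *m Q *m resolvent e (X^T *m Q) *m
    (Q^T *m D *m (X^T *m Q) + (X^T *m Q)^T *m (D^T *m Q)) *m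
    resolvent e (X^T *m Q)).
  by rewrite /dresolvent mulmxN !mulmxA.
under eq_fun do rewrite E.
apply: tameN; apply: (tameM (k := 1) (l := 0)); last exact: tame_resolvent.
apply: (tameM (k := 0) (l := 1)); first exact: tame_gram_resolvent.
apply: tameD.
  by apply: (tameM (k := 0) (l := 1)); [exact: tame_cst|exact: tame_gram_arg].
apply: (tameM (k := 1) (l := 0)); last exact: tame_cst.
by apply: tame_tr; exact: tame_gram_arg.
Qed.

End resolvent_tame.
End tame.

(** * Divergences of the two resolvent fields *)

Section divergence.
Context (R : realType) (a b : nat).

Let mxBE p r (A B : 'M[R]_(p, r)) i j : (A - B) i j = A i j - B i j.
Proof. by rewrite !mxE. Qed.

Let mxDE p r (A B : 'M[R]_(p, r)) i j : (A + B) i j = A i j + B i j.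
Proof. by rewrite mxE. Qed.

(** Summing a derivative along [delta_mx i j] over its entries [(j, i)] computes a divergence. A
    direction that enters transposed separates two traces; one that enters untransposed, as in
    [sum_mul_delta_cross], leaves a single trace. *)
Lemma sum_mul_delta_diag (A : 'M[R]_b) (C : 'M[R]_a) :
  \sum_i \sum_j (A *m (delta_mx i j)^T *m C) j i = \tr A * \tr C.
Proof.
rewrite mulrC mulr_suml; apply: eq_bigr => i _; rewrite mulr_sumr.
apply: eq_bigr => j _; rewrite trmx_delta mxE (bigD1 i)//= big1 ?addr0.
  rewrite mxE (bigD1 j)//= big1 ?addr0; first by rewrite mxE !eqxx mulr1 mulrC.
  by move=> k /negPf kj; rewrite mxE kj mulr0.
move=> k /negPf ki; rewrite mxE big1 ?mul0r// => l _.
by rewrite mxE ki andbF mulr0.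
Qed.

Lemma sum_mul_delta_cross (A C : 'M[R]_(b, a)) :
  \sum_i \sum_j (A *m delta_mx i j *m C) j i = \tr (A *m C^T).
Proof.
rewrite exchange_big; apply: eq_bigr => j _; rewrite mxE.
apply: eq_bigr => i _; rewrite mxE (bigD1 j)//= big1 ?addr0.
  rewrite mxE (bigD1 i)//= big1 ?addr0; first by rewrite !mxE !eqxx mulr1.
  by move=> k /negPf kj; rewrite mxE kj mulr0.
move=> k /negPf ki; rewrite mxE big1 ?mul0r// => l _.
by rewrite mxE ki andbF mulr0.
Qed.

Lemma sum_mul_entry (X : 'M[R]_(a, b)) (F : 'M[R]_(b, a)) :
  \sum_i \sum_j X i j * F j i = \tr (F *m X).
Proof.
rewrite mxtrace_mulC; apply: eq_bigr => i _; rewrite mxE.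
by [].
Qed.

Context (q : nat) (Q : 'M[R]_(a, q)) (e : R) (X : 'M[R]_(a, b)).
Hypotheses (e0 : 0 < e) (QQ : Q^T *m Q = 1%:M).
Local Notation G := (X^T *m Q).
Local Notation M := (resolvent e (X^T *m Q)).
Local Notation W := (X^T *m Q *m resolvent e (X^T *m Q)).

(** With [t = tr M], the field [W Q^T] pairs with [X] to [q - e t] and has divergence
    [b t - (t - e |M|^2) - (q - e t) t]. The difference is the right-hand side minus
    [e (t + t^2 + |M|^2)], and the subtracted term is nonnegative. *)
Lemma stein_resolvent_algebra :
  \sum_i \sum_j (X i j * (W *m Q^T) j i - (dgram_resolvent Q e (delta_mx i j) X *m Q^T) j i) <=
  q%:R - (b%:R - q%:R - 1) * \tr M.
Proof.
under eq_bigr do rewrite sumrB; rewrite sumrB sum_mul_entry.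
have trQ (A : 'M[R]_q) : \tr (Q *m A *m Q^T) = \tr A.
  by rewrite mxtrace_mulC mulmxA QQ mul1mx.
have -> : \tr (W *m Q^T *m X) = q%:R - e * \tr M.
  have GT : Q^T *m X = G^T by rewrite trmx_mul trmxK.
  by rewrite -tr_gram_mul_resolvent// -(mulmxA _ Q^T) GT mxtrace_mulC (mulmxA _ _ M).
have E i j : (dgram_resolvent Q e (delta_mx i j) X *m Q^T) j i =
   (1%:M *m (delta_mx i j)^T *m (Q *m M *m Q^T)) j i
   - (W *m Q^T *m delta_mx i j *m (W *m Q^T)) j i
   - (W *m G^T *m (delta_mx i j)^T *m (Q *m M *m Q^T)) j i.
  rewrite -!mxBE; congr (_ j i).
  rewrite /dgram_resolvent /dresolvent mul1mx !(mulmxDl, mulmxDr, mulmxN, mulNmx) !mulmxA.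
  by rewrite opprD addrA.
under eq_bigr do under eq_bigr do rewrite E.
under eq_bigr do rewrite !sumrB; rewrite !sumrB.
rewrite !sum_mul_delta_diag sum_mul_delta_cross mxtrace1 trQ.
have -> : \tr (W *m G^T) = q%:R - e * \tr M.
  by rewrite -tr_gram_mul_resolvent// mxtrace_mulC (mulmxA _ _ M).
have -> : \tr (W *m Q^T *m (W *m Q^T)^T) = \tr M - e * nsq M.
  rewrite trmx_mul trmxK mulmxA -(mulmxA W) QQ mulmx1 mxtrace_mulC -/(nsq _).
  by rewrite nsq_mul_resolvent_eq.
have := mulr_ge0 (ltW e0) (nsq_ge0 M).
have := mulr_ge0 (ltW e0) (tr_resolvent_ge0 (X^T *m Q) e0).
have := mulr_ge0 (ltW e0) (sqr_ge0 (\tr M)).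
nra.
Qed.

Context (c : nat) (E : 'M[R]_(a, c)).
Hypothesis QE : Q^T *m E = 0.
Local Notation H := (X^T *m E).

(** The field is [W W^T X^T E E^T]. Of the seven terms of its divergence, six bring [Q] next to [E]
    inside a trace and vanish. What survives comes from differentiating the explicit [X^T]: it is
    [tr (W W^T) * tr (E E^T)]. *)
Lemma stein_projection_algebra :
  \sum_i \sum_j (X i j * (W *m W^T *m X^T *m (E *m E^T)) j i -
    (dgram_resolvent Q e (delta_mx i j) X *m (W^T *m (X^T *m (E *m E^T))) +
     W *m ((dgram_resolvent Q e (delta_mx i j) X)^T *m (X^T *m (E *m E^T)) +
           W^T *m ((delta_mx i j)^T *m (E *m E^T)))) j i) =
  nsq (W^T *m X^T *m E) - nsq W * nsq E.
Proof.
under eq_bigr do rewrite sumrB; rewrite sumrB sum_mul_entry; congr (_ - _).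
  rewrite /nsq !trmx_mul !trmxK !mulmxA mxtrace_mulC !mulmxA.
  by rewrite [LHS]mxtrace_mulC !mulmxA.
have dWT D : (dgram_resolvent Q e D X)^T = M *m Q^T *m D -
    M *m (G^T *m (D^T *m Q) + Q^T *m D *m G) *m W^T.
  rewrite /dgram_resolvent /dresolvent [(_ + _)^T]linearD/= mulmxN [(- _)^T]linearN/= !trmx_mul.
  rewrite !trmxK [(_ + _)^T]linearD/= !trmx_mul !trmxK resolvent_tr.
  by rewrite !mulmxA.
have EQ : E^T *m Q = 0 by rewrite -[LHS]trmxK trmx_mul trmxK QE trmx0.
have Qtr p (A : 'M[R]_(q, p)) (B : 'M[R]_(p, c)) : \tr (Q *m A *m (B *m E^T)) = 0.
  by rewrite mulmxA mxtrace_mulC !mulmxA EQ !mul0mx mxtrace0.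
pose Z := W^T *m H.
have F i j : (dgram_resolvent Q e (delta_mx i j) X *m (W^T *m (X^T *m (E *m E^T))) +
     W *m ((dgram_resolvent Q e (delta_mx i j) X)^T *m (X^T *m (E *m E^T)) +
           W^T *m ((delta_mx i j)^T *m (E *m E^T)))) j i =
   (1%:M *m (delta_mx i j)^T *m (Q *m M *m (Z *m E^T))) j i
   - (W *m Q^T *m delta_mx i j *m (W *m Z *m E^T)) j i
   - (W *m G^T *m (delta_mx i j)^T *m (Q *m M *m (Z *m E^T))) j i
   + (W *m M *m Q^T *m delta_mx i j *m (H *m E^T)) j i
   - (W *m M *m G^T *m (delta_mx i j)^T *m (Q *m 1%:M *m (Z *m E^T))) j i
   - (W *m M *m Q^T *m delta_mx i j *m (G *m Z *m E^T)) j i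
   + (W *m W^T *m (delta_mx i j)^T *m (E *m E^T)) j i.
  rewrite -!(mxBE, mxDE); congr (_ j i).
  rewrite dWT /dgram_resolvent /dresolvent /Z mul1mx mulmx1.
  by rewrite !(mulmxDl, mulmxDr, mulmxN, mulNmx, opprD) !mulmxA !addrA.
under eq_bigr do under eq_bigr do rewrite F.
under eq_bigr do rewrite !(sumrB, big_split)/=.
rewrite !(sumrB, big_split)/=.
have Etr (A : 'M[R]_(b, q)) (B : 'M[R]_(b, c)) : \tr (A *m Q^T *m (B *m E^T)^T) = 0.
  by rewrite trmx_mul trmxK mulmxA -(mulmxA A) QE mulmx0 mul0mx mxtrace0.
rewrite !sum_mul_delta_diag !sum_mul_delta_cross !Qtr !Etr !mulr0 !subr0 !add0r.
by rewrite -(nsqT W) /nsq trmxK (mxtrace_mulC E).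
Qed.

End divergence.

(** * Gaussian integration by parts *)

Section standard_normal_integral.
Context (R : realType).
Local Notation lam := (@lebesgue_measure R).
Local Notation gauss := (normal_prob (0 : R) 1).
Local Notation phi := (normal_pdf (0 : R) 1).

(** Both functions have the same integral over every measurable set, so they agree almost
    everywhere. *)
Let ae_eq_normal_density : ae_eq lam setT
  (Radon_Nikodym_SigmaFinite.f gauss lam) (EFin \o phi).
Proof.
have dom := @normal_prob_dominates R 0 1.
apply: integral_ae_eq => //.
- exact: Radon_Nikodym_SigmaFinite.f_integrable.
- by apply/measurable_EFinP; exact: measurable_normal_pdf.
- by move=> E _ mE; rewrite -Radon_Nikodym_SigmaFinite.f_integral.
Qed.

Lemma ge0_integral_standard_normal (f : R -> \bar R) :
  measurable_fun setT f -> (forall x, 0 <= f x)%E ->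
  (\int[gauss]_x f x = \int[lam]_x (f x * (phi x)%:E))%E.
Proof.
move=> mf f0; have dom := @normal_prob_dominates R 0 1.
rewrite -(Radon_Nikodym_SigmaFinite.change_of_variables dom)//.
apply: ae_eq_integral => //.
- apply: emeasurable_funM => //.
  exact: measurable_int (Radon_Nikodym_SigmaFinite.f_integrable dom).
- by apply: emeasurable_funM => //; apply/measurable_EFinP; exact: measurable_normal_pdf.
- exact: ae_eqe_mul2l.
Qed.

Lemma integral_standard_normal (f : R -> \bar R) : gauss.-integrable setT f ->
  (\int[gauss]_x f x = \int[lam]_x (f x * (phi x)%:E))%E.
Proof.
move=> intf; have dom := @normal_prob_dominates R 0 1.
have mf := measurable_int _ intf.
rewrite -(Radon_Nikodym_change_of_variables dom)//.
apply: ae_eq_integral => //.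
- by apply: emeasurable_funM => //; apply: measurable_int (Radon_Nikodym_integrable _).
- by apply: emeasurable_funM => //; apply/measurable_EFinP; exact: measurable_normal_pdf.
- apply: ae_eqe_mul2l; apply: ae_eq_trans ae_eq_normal_density.
  by apply/ae_eq_sym; exact: ae_eq_Radon_Nikodym_SigmaFinite.
Qed.

Lemma standard_normal_pdfE x :
  phi x = normal_peak (1 : R) * expR (- (x ^+ 2 / 2)).
Proof.
by rewrite normal_pdfE ?oner_neq0// /normal_fun subr0 expr1n mulNr.
Qed.

(** Half of the exponent is spent on the polynomial: [(1 + y)^2 <= 8 (1 + y^2 / 4) <= 8 exp (y^2 /
    4)]. What remains is, up to a constant, the normal density of variance 2. *)
Lemma quadratic_normal_pdf_le x :
  (1 + `|x|) ^+ 2 * phi x <= 8 * normal_peak (1 : R) * expR (- (x ^+ 2 / 4)).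
Proof.
rewrite standard_normal_pdfE (_ : x ^+ 2 / 2 = x ^+ 2 / 4 + x ^+ 2 / 4); last by field.
rewrite opprD expRD [leLHS](_ : _ = normal_peak 1 * expR (- (x ^+ 2 / 4)) *
  ((1 + `|x|) ^+ 2 * expR (- (x ^+ 2 / 4)))); last by ring.
rewrite [leRHS](_ : _ = normal_peak 1 * expR (- (x ^+ 2 / 4)) * 8); last by ring.
rewrite ler_wpM2l ?mulr_ge0 ?normal_peak_ge0 ?expR_ge0//.
rewrite expRN ler_pdivrMr ?expR_gt0//.
have := expR_ge1Dx (x ^+ 2 / 4); rewrite -real_normK ?num_real//.
have := normr_ge0 x; have := sqr_ge0 (`|x| - 1); set y := `|x|; nra.
Qed.

Lemma integrable_quadratic_normal :
  lam.-integrable setT (fun x => ((1 + `|x|) ^+ 2 * phi x)%:E).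
Proof.
have s2 : Num.sqrt (2 : R) != 0 by rewrite sqrtr_eq0 -ltNge.
(* Dividing by the peak of the density of standard deviation [sqrt 2] turns [exp (- x^2 / 4)] into
   that integrable density. *)
pose c : R := 8 * normal_peak 1 * (normal_peak (Num.sqrt 2))^-1.
apply: (le_integrable _ _ _ (integrableZl measurableT c
  (@integrable_normal_pdf R 0 (Num.sqrt 2)))) => //.
  apply/measurable_EFinP; apply: measurable_funM; last exact: measurable_normal_pdf.
  by apply: measurable_funX; apply: measurable_funD => //; exact: normr_measurable.
have c0 : 0 <= c.
  apply: mulr_ge0; last by rewrite invr_ge0 normal_peak_ge0.
  by apply: mulr_ge0 => //; exact: normal_peak_ge0.
move=> x _; rewrite -EFinM lee_fin ger0_norm; last first.
  by apply: mulr_ge0; [exact: sqr_ge0|exact: normal_pdf_ge0].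
rewrite ger0_norm; last by apply: mulr_ge0 => //; exact: normal_pdf_ge0.
apply: (le_trans (quadratic_normal_pdf_le x)).
rewrite normal_pdfE// /normal_fun subr0 sqr_sqrtr// mulNr.
rewrite (_ : (2 : R) *+ 2 = 4); last by rewrite -mulrnA.
by rewrite /c mulrA mulfVK// gt_eqF// normal_peak_gt0.
Qed.

Lemma integrable_quadratic_standard_normal :
  gauss.-integrable setT (fun x => ((1 + `|x|) ^+ 2)%:E).
Proof.
have mq : measurable_fun setT (fun x : R => (1 + `|x|) ^+ 2).
  by apply: measurable_funX; apply: measurable_funD => //; exact: normr_measurable.
apply/integrableP; split; first exact/measurable_EFinP.
rewrite ge0_integral_standard_normal//; last first.
  by apply: measurableT_comp => //; exact/measurable_EFinP.
have /integrableP[_] := integrable_quadratic_normal; congr (_ < _)%E.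
apply: eq_integral => x _; rewrite EFinM abseM; congr (_ * _)%E.
by rewrite gee0_abs// lee_fin normal_pdf_ge0.
Qed.

Lemma is_derive_standard_normal_pdf (x : R) : is_derive x 1 phi (- x * phi x).
Proof.
rewrite (_ : phi = cst (normal_peak 1) * (expR \o (fun x => - 2^-1 * x ^+ 2))); last first.
  apply/funext => y; rewrite standard_normal_pdfE /=; congr (_ * expR _).
  by rewrite mulrC mulNr.
apply: is_derive_eq; rewrite /= /GRing.scale/= /cst !fctE/=.
by field.
Qed.

(** The function [- f phi] is an antiderivative of [(x f - f') phi]. On [[-n-1, n+1]] only boundary
    values remain and they tend to 0, while dominated convergence extends the integral to the whole
    line. *)
Lemma stein_standard_normal (f f' : R -> R) K :
  (forall x : R, is_derive x 1 f (f' x)) -> continuous f' ->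
  (forall x, `|f x| <= K * (1 + `|x|) ^+ 2) ->
  (forall x, `|x * f x| <= K * (1 + `|x|) ^+ 2) ->
  (forall x, `|f' x| <= K * (1 + `|x|) ^+ 2) ->
  (\int[gauss]_x (x * f x - f' x)%:E = 0)%E.
Proof.
move=> df cf' bf bxf bf'.
have cf : continuous f.
  move=> x; apply: differentiable_continuous; apply/derivable1_diffP.
  by have [] := df x.
have cphi : continuous phi by apply: continuous_normal_pdf; rewrite oner_neq0.
pose h x := x * f x - f' x; pose g x := h x * phi x.
have ch : continuous h.
  move=> x; apply: (@cvgB _ R^o _ _ _ (fun x => x * f x) f'); last exact: cf'.
  by apply: (@cvgM _ _ _ _ id f); [exact: cvg_id|exact: cf].
have cg : continuous g by move=> x; apply: (@cvgM _ _ _ _ h phi); [exact: ch|exact: cphi].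
have mh : measurable_fun setT h by exact: continuous_measurable_fun.
have mg : measurable_fun setT g by exact: continuous_measurable_fun.
have hle x : `|h x| <= 2 * K * (1 + `|x|) ^+ 2.
  rewrite -mulrA mulr_natl mulr2n (le_trans (ler_normB _ _))// lerD//.
have gle x : `|g x| <= 2 * K * ((1 + `|x|) ^+ 2 * phi x).
  by rewrite normrM mulrA [X in _ * X]ger0_norm ?normal_pdf_ge0// ler_wpM2r ?normal_pdf_ge0.
have inth : gauss.-integrable setT (EFin \o h).
  apply: (le_integrable _ _ _ (integrableZl measurableT (2 * K)
    integrable_quadratic_standard_normal)) => //; first exact/measurable_EFinP.
  by move=> x _; rewrite -EFinM lee_fin (le_trans (hle x))// ler_norm.
rewrite [LHS](integral_standard_normal inth).
have dF (x : R) : is_derive x 1 (f * phi) (- g x).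
  apply: is_derive_eq; first exact: is_deriveM (df x) (is_derive_standard_normal_pdf x).
  by rewrite /g /h /GRing.scale/=; ring.
pose D n := `[(- n.+1%:R : R), n.+1%:R]%classic.
have ftc n : (\int[lam]_(x in D n) (g x)%:E =
    (- (f n.+1%:R * phi n.+1%:R - f (- n.+1%:R) * phi (- n.+1%:R)))%:E)%E.
  have cF : continuous (- (f * phi)).
    move=> x; apply: (@cvgN _ R^o _ _ _ (f * phi)).
    by apply: (@cvgM _ _ _ _ f phi); [exact: cf|exact: cphi].
  rewrite (@continuous_FTC2 _ g (- (f * phi))).
  - by rewrite -EFinB !fctE; congr EFin; ring.
  - by rewrite gtrN.
  - exact: continuous_subspaceT.
  - split.
    + move=> x _; apply: derivableN; by have [] := dF x.
    + by apply: cvg_at_right_filter; exact: cF.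
    + by apply: cvg_at_left_filter; exact: cF.
  - move=> x _; rewrite derive1E deriveN; last by have [] := dF x.
    by have [_ ->] := dF x; rewrite opprK.
have cvg1 : (\int[lam]_(x in D n) (g x)%:E)%E @[n --> \oo] --> (\int[lam]_x (g x)%:E)%E.
  under eq_fun do rewrite integral_mkcond.
  have [] // := @dominated_convergence _ _ _ lam setT measurableT
    (fun n => (EFin \o g) \_ (D n)) (EFin \o g)
    (fun x => (2 * K * ((1 + `|x|) ^+ 2 * phi x))%:E).
  - move=> n; have mD : measurable (D n) by exact: measurable_itv.
    apply: (iffLR (measurable_restrictT _ mD)).
    by apply: measurable_funTS; exact/measurable_EFinP.
  - exact/measurable_EFinP.
  - apply: aeW => x _; apply: cvg_near_cst; near=> n.
    rewrite patchE mem_set// /D/= in_itv/= -ler_norml.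
    near: n; exists (Num.trunc `|x|) => // n /= xn.
    by rewrite ltW// (lt_le_trans (truncnS_gt _))// ler_nat ltnS.
  - under eq_fun do rewrite EFinM.
    by apply: integrableZl => //; exact: integrable_quadratic_normal.
  - apply: aeW => x n _; rewrite patchE; case: ifP => _; first by rewrite lee_fin.
    by rewrite abse0 lee_fin (le_trans _ (gle x)).
suff cvg2 : (\int[lam]_(x in D n) (g x)%:E)%E @[n --> \oo] --> (0:R)%:E.
  exact: cvg_unique cvg1 cvg2.
under eq_fun do rewrite ftc.
apply: cvg_EFin; first exact: nearW.
rewrite (_ : fine \o _ = fun n =>
  - (f n.+1%:R * phi n.+1%:R - f (- n.+1%:R) * phi (- n.+1%:R)))//.
(* With [y = n + 1], [exp (y^2 / 4) >= 1 + y^2 / 4 >= y / 4] bounds the Gaussian factor by [4 / y];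
   hence [32 = 8 * 4]. *)
have decay n x : `|x| = n.+1%:R ->
    `|f x * phi x| <= K * (32 * normal_peak 1) * harmonic n.
  move=> xn; have K0 : 0 <= K.
    by have := le_trans (normr_ge0 _) (bf 0); rewrite normr0 addr0 expr1n mulr1.
  rewrite normrM [X in _ * X]ger0_norm ?normal_pdf_ge0//.
  apply: (le_trans (ler_wpM2r (normal_pdf_ge0 _ _ _) (bf x))).
  rewrite -[leLHS]mulrA -[leRHS]mulrA; apply: ler_wpM2l => //.
  apply: (le_trans (quadratic_normal_pdf_le x)).
  rewrite (_ : 32 * normal_peak 1 * harmonic n =
    8 * normal_peak 1 * (4 * harmonic n)); last by ring.
  rewrite ler_wpM2l ?mulr_ge0 ?normal_peak_ge0//.
  rewrite expRN invf_ple ?posrE ?expR_gt0 ?mulr_gt0 ?invr_gt0//.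
  apply: le_trans (expR_ge1Dx _); rewrite /harmonic/= invfM invrK -real_normK ?num_real// xn.
  have : (1 : R) <= n.+1%:R by rewrite ler1n.
  set y := n.+1%:R; nra.
apply: norm_cvg0; apply: (@squeeze_cvgr _ _ _ _ (cst 0)
  (fun n => 2 * (K * (32 * normal_peak 1)) * harmonic n)).
- apply: nearW => n; rewrite normr_ge0/= normrN (le_trans (ler_normB _ _))//.
  by rewrite -mulrA mulr_natl mulr2n lerD//; apply: decay; rewrite ?normrN ger0_norm.
- exact: cvg_cst.
- rewrite -[X in _ --> X](mulr0 (2 * (K * (32 * normal_peak 1)))).
  by apply: cvgMr; exact: cvg_harmonic.
Unshelve. all: by end_near. Qed.

End standard_normal_integral.

Lemma pushforward_measure_ex d1 d2 (T1 : measurableType d1)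
    (T2 : measurableType d2) (R : realType) (m : {measure set T1 -> \bar R})
    (f : T1 -> T2) : measurable_fun setT f ->
  exists nu : {measure set T2 -> \bar R}, nu = pushforward m f :> (set T2 -> \bar R).
Proof. by move=> mf; unshelve (eexists; reflexivity). Qed.

Section resampling.
Context (dT : measure_display) (T : measurableType dT) (R : realType).
Context (P : probability T R) (a b : nat) (X : {RV P >-> 'M[R]_(a, b)}).
Local Notation gauss := (normal_prob (0 : R) 1).
Hypothesis gX : gaussian_matrix X.

Definition resample i j (z : R * 'M[R]_(a, b)) : 'M[R]_(a, b) :=
  z.2 + (z.1 - z.2 i j) *: delta_mx i j.

Lemma resampleE i j z k l :
  resample i j z k l = if (k == i) && (l == j) then z.1 else z.2 k l.
Proof.
rewrite !mxE; case: ifPn => [/andP[/eqP -> /eqP ->]|_].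
  by rewrite mulr1 addrC subrK.
by rewrite mulr0 addr0.
Qed.

Lemma measurable_resample i j :
  measurable_fun setT (resample i j : measurableTypeR R * 'M[R]_(a, b) -> _).
Proof.
apply/measurable_fun_mxP => k l; rewrite [X in measurable_fun _ X](_ : _ =
  fun z : measurableTypeR R * 'M[R]_(a, b) =>
    if (k == i) && (l == j) then z.1 else z.2 k l); last first.
  by apply/funext => z; exact: resampleE.
case: (_ && _); first exact: measurable_fst.
exact: (measurableT_comp (measurable_mx_entry k l) measurable_snd).
Qed.

Definition box (B : 'I_a -> 'I_b -> set R) : set 'M[R]_(a, b) :=
  [set M | forall i j, B i j (M i j)].

Lemma measurable_box B : (forall i j, measurable (B i j)) -> measurable (box B).
Proof.
move=> mB; rewrite (_ : box B = \bigcap_(ij in [set: 'I_a * 'I_b])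
    ((fun M : 'M[R]_(a, b) => M ij.1 ij.2) @^-1` B ij.1 ij.2)).
  apply: fin_bigcap_measurable => // -[i j] _ /=.
  by have := @measurable_mx_entry _ _ a b i j measurableT _ (mB i j); rewrite setTI.
apply/seteqP; split => [M BM [i j] _ |M BM i j]; first exact: BM.
exact: (BM (i, j)).
Qed.

(** The defining generators restrict a single entry and are not stable under intersection. Boxes
    are, as uniqueness of measures requires. *)
Lemma mx_measurable_generated : @measurable _ 'M[R]_(a, b) =
  <<s [set box B | B in [set B | forall i j, measurable (B i j)]] >>.
Proof.
apply/seteqP; split; last first.
  apply: smallest_sub; first exact: sigma_algebra_measurable.
  by move=> _ [B mB <-]; exact: measurable_box.
apply: smallest_sub; first exact: smallest_sigma_algebra.
move=> _ [[i j] _ [B mB <-]]; apply: sub_sigma_algebra.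
exists (fun k l => if (k == i) && (l == j) then B else setT).
  by move=> k l; case: ifP.
rewrite setTI; apply/seteqP; split => M /=.
  by move=> /(_ i j); rewrite !eqxx.
by move=> BM k l; case: ifPn => // /andP[/eqP -> /eqP ->].
Qed.

Lemma gaussian_box B : (forall i j, measurable (B i j)) ->
  P (X @^-1` box B) = (\prod_(ij : 'I_a * 'I_b) gauss (B ij.1 ij.2))%E.
Proof.
move=> mB; have [gX1 gX2] := gX.
have := gX2 [set: 'I_a * 'I_b]%SET (fun ij => B ij.1 ij.2) (fun ij => mB _ _).
rewrite (_ : \bigcap_(_ in _) _ = X @^-1` box B); last first.
  apply/seteqP; split => w /=; first by move=> h i j; apply: (h (i, j)); rewrite /= inE.
  by move=> h [i j] _ /=; exact: h.
move=> ->; apply: eq_big => [ij|[i j] _]; first by rewrite inE.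
by rewrite /= gX1.
Qed.

Let mX : measurable_fun setT X. Proof. exact: measurable_funPT. Qed.

Let mXX : measurable_fun setT (fun z : measurableTypeR R * T => (z.1, X z.2)).
Proof.
apply/measurable_fun_pairP; split; first exact: measurable_fst.
by apply: (measurableT_comp mX); exact: measurable_snd.
Qed.

Let mresX i j : measurable_fun setT
  (fun z : measurableTypeR R * T => resample i j (z.1, X z.2)).
Proof. exact: (measurableT_comp (measurable_resample i j) mXX). Qed.

(** Independence makes the probability of a box a product over the entries, and redrawing one entry
    from the same normal law leaves that product unchanged. *)
Lemma gaussian_resample_measure i j (A : set 'M[R]_(a, b)) : measurable A ->
  pushforward P X A =
  pushforward (gauss \x P)%E (fun z : R * T => resample i j (z.1, X z.2)) A.
Proof.
have [m1 m1E] := pushforward_measure_ex P mX.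
have [m2 m2E] := pushforward_measure_ex (gauss \x P)%E (@mresX i j).
rewrite -m1E -m2E => mA.
apply: (measure_unique _ (fun=> setT) mx_measurable_generated) => //.
- move=> _ _ [B mB <-] [C mC <-]; exists (fun i j => B i j `&` C i j).
    by move=> k l; exact: measurableI.
  apply/seteqP; split => [M BC|M [BM CM] k l]; last by split.
  by split=> k l; have [] := BC k l.
- by move=> _; exists (fun _ _ => setT) => //; apply/seteqP; split.
- by rewrite bigcup_const.
- move=> _ [B mB <-]; rewrite m1E m2E /pushforward [LHS](gaussian_box mB).
  (* The old value of the redrawn entry is overwritten, hence unconstrained; its factor becomes the
     total mass 1. *)
  pose B' k l := if (k == i) && (l == j) then setT else B k l.
  have -> : (fun z : R * T => resample i j (z.1, X z.2)) @^-1` box B =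
      B i j `*` (X @^-1` box B').
    apply/seteqP; split => [[x w] /= h|[x w] /= [Bx BX] k l]; last first.
      rewrite resampleE/=; case: ifPn => [/andP[/eqP -> /eqP ->]//|kl].
      by have := BX k l; rewrite /B' (negPf kl).
    split; first by have := h i j; rewrite resampleE !eqxx.
    move=> k l; rewrite /B'; case: ifPn => // kl.
    by have := h k l; rewrite resampleE (negPf kl).
  have mB' k l : measurable (B' k l) by rewrite /B'; case: ifP.
  rewrite [RHS]product_measure1E//; last first.
    by rewrite -[X in measurable X]setTI; apply: mX => //; exact: measurable_box.
  exact: mB.
  rewrite [X in (_ * X)%E](gaussian_box mB') (bigD1 (i, j))//= [in RHS](bigD1 (i, j))//=.
  rewrite /B' !eqxx/= probability_setT mul1e; congr (_ * _)%E.
  apply: eq_bigr => -[k l]; rewrite xpair_eqE => /= /negPf kl.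
  by rewrite kl.
- move=> _; rewrite m1E; apply: (le_lt_trans (probability_le1 P _)); last exact: ltry.
  by rewrite preimage_setT.
Qed.

(* Stands in for conditioning on all entries but one. *)
Lemma ge0_gaussian_resample i j (f : 'M[R]_(a, b) -> \bar R) :
  measurable_fun setT f -> (forall M, 0 <= f M)%E ->
  (\int[P]_w f (X w) = \int[P]_w \int[gauss]_x f (resample i j (x, X w)))%E.
Proof.
move=> mf f0; transitivity (\int[pushforward P X]_M f M)%E.
  by rewrite ge0_integral_pushforward.
transitivity (\int[pushforward (gauss \x P)%E
  (fun z : R * T => resample i j (z.1, X z.2))]_M f M)%E.
  have [m1 m1E] := pushforward_measure_ex P mX.
  have [m2 m2E] := pushforward_measure_ex (gauss \x P)%E (@mresX i j).
  rewrite -m1E -m2E; apply: eq_measure_integral => A mA _.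
  by rewrite m1E m2E; exact: gaussian_resample_measure.
rewrite (ge0_integral_pushforward (@mresX i j))//.
rewrite preimage_setT (fubini_tonelli2 (f \o _))//.
exact: measurableT_comp.
by move=> z; exact: f0.
Qed.

End resampling.

Section matrix_stein.
Context (dT : measure_display) (T : measurableType dT) (R : realType).
Context (P : probability T R) (a b : nat) (X : {RV P >-> 'M[R]_(a, b)}).
Local Notation gauss := (normal_prob (0 : R) 1).
Hypothesis gX : gaussian_matrix X.

Let mX : measurable_fun setT X. Proof. exact: measurable_funPT. Qed.

(** [(1 + s)^2 <= 2 + 2 s^2], followed by Cauchy-Schwarz against the constant 1. *)
Lemma mx_size_sqr_le (M : 'M[R]_(a, b)) :
  mx_size M ^+ 2 <=
  2 + 2 * #|{: 'I_a * 'I_b}|%:R * \sum_(ij : 'I_a * 'I_b) M ij.1 ij.2 ^+ 2.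
Proof.
rewrite /mx_size pair_big/=; set s := \sum_p _.
have /= := sum_cauchy_schwarz (fun p : 'I_a * 'I_b => `|M p.1 p.2|) (fun=> 1).
under eq_bigr do rewrite mulr1; rewrite -/s.
under eq_bigr do rewrite real_normK ?num_real//.
under [X in _ * X]eq_bigr do rewrite expr1n.
rewrite sumr_const; set S := \sum_p _; set c : R := _%:R => h.
have := sqr_ge0 (1 - s); nra.
Qed.

Lemma integrable_gaussian_entry_sqr i j :
  P.-integrable setT (fun w => (X w i j ^+ 2)%:E).
Proof.
have mXij : measurable_fun setT (fun w => X w i j).
  exact: (measurableT_comp (measurable_mx_entry i j) mX).
have m2 : measurable_fun setT (fun x : R => (x ^+ 2)%:E).
  by apply/measurable_EFinP; exact: exprn_measurable.
apply/integrableP; split; first exact: (measurableT_comp m2 mXij).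
under eq_integral do rewrite gee0_abs ?lee_fin ?sqr_ge0//.
have -> : (\int[P]_w (X w i j ^+ 2)%:E = \int[gauss]_x (x ^+ 2)%:E)%E.
  pose Xij : T -> measurableTypeR R := fun w => X w i j.
  have mXij' : measurable_fun setT Xij by [].
  have [m mE] := pushforward_measure_ex P mXij'.
  transitivity (\int[m]_x ((x : R) ^+ 2)%:E)%E.
    by rewrite mE ge0_integral_pushforward// => x _; rewrite lee_fin sqr_ge0.
  apply: eq_measure_integral => A mA _.
  by rewrite mE; have [gX1 _] := gX; exact: gX1.
have /integrableP[_] := @integrable_quadratic_standard_normal R.
apply: le_lt_trans; apply: ge0_le_integral => //.
- by move=> x _; rewrite lee_fin sqr_ge0.
- apply: measurableT_comp => //; apply/measurable_EFinP; apply: measurable_funX.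
  by apply: measurable_funD => //; exact: normr_measurable.
- move=> x _; rewrite lee_fin ger0_norm ?sqr_ge0// -real_normK ?num_real//.
  by rewrite ler_pXn2r ?nnegrE ?addr_ge0// lerDr.
Qed.

Lemma integrable_dominated (f : 'M[R]_(a, b) -> R) K :
  measurable_fun setT f -> (forall M, `|f M| <= K * mx_size M ^+ 2) ->
  P.-integrable setT (fun w => (f (X w))%:E).
Proof.
move=> mf bf; pose c : R := 2 * #|{: 'I_a * 'I_b}|%:R.
apply: (@le_integrable _ _ _ P setT measurableT _
  (fun w => (`|K| * (2 + c * \sum_(ij : 'I_a * 'I_b) X w ij.1 ij.2 ^+ 2))%:E)).
- by apply/measurable_EFinP; exact: (measurableT_comp mf mX).
- move=> w _; rewrite lee_fin (le_trans (bf _))// (le_trans _ (ler_norm _))//.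
  apply: (@le_trans _ _ (`|K| * mx_size (X w) ^+ 2)).
    by rewrite ler_wpM2r ?sqr_ge0// ler_norm.
  by rewrite ler_wpM2l// mx_size_sqr_le.
under eq_fun do rewrite EFinM EFinD EFinM -sumEFin.
apply: integrableZl => //; apply: integrableD => //.
  exact: finite_measure_integrable_cst.
apply: integrableZl => //; apply: integrable_sum => // p _.
exact: integrable_gaussian_entry_sqr.
Qed.

Lemma is_derive_line (f : 'M[R]_(a, b) -> R) (M D : 'M[R]_(a, b)) (x d : R) :
  is_derive (M + x *: D) D f d -> is_derive x 1 (fun y => f (M + y *: D)) d.
Proof.
pose g y := f (M + y *: D).
have E : (fun h => h^-1 *: ((g \o shift x) (h *: 1) - g x)) =
    (fun h => h^-1 *: ((f \o shift (M + x *: D)) (h *: D) - f (M + x *: D))).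
  apply/funext => h /=; rewrite /g; congr (_ *: (f _ - _)).
  by rewrite [_ *: 1]mulr1 scalerDl addrCA.
move=> [df dE]; apply: DeriveDef; first by move: df; rewrite /derivable E.
by move: dE; rewrite /derive E.
Qed.

Lemma resample_line i j x (M : 'M[R]_(a, b)) :
  resample i j (x, M) = (M - M i j *: delta_mx i j) + x *: delta_mx i j.
Proof. by rewrite /resample/= scalerBl addrA addrAC. Qed.

(** The product form separates the fixed entries from the fresh one, matching the growth hypotheses
    of [stein_standard_normal]. *)
Lemma mx_size_resample_le i j x (M : 'M[R]_(a, b)) :
  mx_size (resample i j (x, M)) <= mx_size M * (1 + `|x|).
Proof.
apply: (@le_trans _ _ (mx_size M + `|x|)); last first.
  by rewrite mulrDr mulr1 lerD2l ler_peMl// mx_size_ge1.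
rewrite /mx_size !pair_big/= -addrA lerD2l (bigD1 (i, j))//= resampleE !eqxx/=.
rewrite [leLHS]addrC lerD2r.
rewrite [leRHS](bigD1 (i, j))//= -[leLHS]add0r lerD//.
apply: ler_sum => -[k l]; rewrite xpair_eqE => kl.
by rewrite resampleE/= (negPf kl).
Qed.

(** After redrawing entry [(i, j)], the inner integral is the one-variable identity along a line, so
    it vanishes for each value of the other entries. *)
Lemma gaussian_stein i j (f f' : 'M[R]_(a, b) -> R) K :
  measurable_fun setT f -> measurable_fun setT f' ->
  (forall M, is_derive M (delta_mx i j) f (f' M)) ->
  (forall M, derivable f' M (delta_mx i j)) ->
  (forall M, `|f M| <= K * mx_size M ^+ 2) ->
  (forall M : 'M[R]_(a, b), `|M i j * f M| <= K * mx_size M ^+ 2) ->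
  (forall M, `|f' M| <= K * mx_size M ^+ 2) ->
  (\int[P]_w (X w i j * f (X w) - f' (X w))%:E = 0)%E.
Proof.
move=> mf mf' df df' bf bxf bf'.
pose h (M : 'M[R]_(a, b)) := M i j * f M - f' M.
have mh : measurable_fun setT h.
  apply: measurable_funB => //; apply: measurable_funM => //.
  exact: measurable_mx_entry.
have bh M : `|h M| <= 2 * K * mx_size M ^+ 2.
  by rewrite -mulrA mulr_natl mulr2n (le_trans (ler_normB _ _))// lerD.
have inner M : (\int[gauss]_x (h (resample i j (x, M)))%:E = 0)%E.
  (* Zeroing entry [(i, j)] makes the line parameter equal to the redrawn entry. *)
  pose M0 := M - M i j *: delta_mx i j.
  have K0 : 0 <= K.
    have := le_trans (normr_ge0 _) (bf 0); rewrite pmulr_lge0// exprn_gt0//.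
    exact: mx_size_gt0.
  have grow (g : 'M[R]_(a, b) -> R) : (forall M, `|g M| <= K * mx_size M ^+ 2) ->
      forall x, `|g (M0 + x *: delta_mx i j)| <= (K * mx_size M ^+ 2) * (1 + `|x|) ^+ 2.
    move=> bg x; rewrite -resample_line (le_trans (bg _))// -mulrA ler_wpM2l//.
    rewrite -exprMn ler_pXn2r ?nnegrE ?mx_size_resample_le//.
      exact: ltW (mx_size_gt0 _).
    by apply: mulr_ge0; [exact: ltW (mx_size_gt0 _)|exact: addr_ge0].
  have entry x : (M0 + x *: delta_mx i j) i j = x.
    by rewrite -resample_line resampleE !eqxx.
  under eq_integral do rewrite /h resample_line -/M0 entry.
  apply: (@stein_standard_normal R (fun x => f (M0 + x *: delta_mx i j))
    (fun x => f' (M0 + x *: delta_mx i j)) (K * mx_size M ^+ 2)).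
  - by move=> x; apply: is_derive_line; exact: df.
  - move=> x; apply: differentiable_continuous; apply/derivable1_diffP.
    have [] // : is_derive x 1 (fun y => f' (M0 + y *: delta_mx i j))
      ('D_(delta_mx i j) f' (M0 + x *: delta_mx i j)).
    by apply: is_derive_line; apply: derivableP; exact: df'.
  - exact: grow.
  - by move=> x; have := grow _ bxf x; rewrite entry.
  - exact: grow.
have ih : P.-integrable setT (EFin \o (h \o X)) by exact: integrable_dominated bh.
(* Resampling is available for nonnegative functions, so the two parts of [h] are treated
   separately; their inner integrals coincide since the difference is 0. *)
pose hp M : \bar R := ((EFin \o h)^\+ M)%E; pose hn M : \bar R := ((EFin \o h)^\- M)%E.
have mEh : measurable_fun setT (EFin \o h) by exact/measurable_EFinP.
have mhp : measurable_fun setT hp by exact: measurable_funepos.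
have mhn : measurable_fun setT hn by exact: measurable_funeneg.
have E : (\int[P]_w hp (X w) = \int[P]_w hn (X w))%E.
  rewrite (ge0_gaussian_resample gX i j mhp); last by move=> M; exact: funepos_ge0.
  rewrite (ge0_gaussian_resample gX i j mhn); last by move=> M; exact: funeneg_ge0.
  apply: eq_integral => w _.
  have uv : (\int[gauss]_x hp (resample i j (x, X w)) -
      \int[gauss]_x hn (resample i j (x, X w)) = 0)%E.
    have := inner (X w); rewrite integralE => <-; congr (_ + - _)%E.
      by apply: eq_integral => x _; rewrite /hp !funeposE.
    by apply: eq_integral => x _; rewrite /hn !funenegE.
  move: uv; set u := (\int[_]_x hp _)%E; set v := (\int[_]_x hn _)%E.
  by case: u v => [u| |] [v| |]//= [] /eqP; rewrite subr_eq0 => /eqP ->.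
rewrite -[LHS]/(\int[P]_w (EFin \o (h \o X)) w)%E integralE.
have := integrable_pos_fin_num measurableT ih.
have -> : (\int[P]_w (EFin \o (h \o X))^\- w =
    \int[P]_w (EFin \o (h \o X))^\+ w)%E.
  transitivity (\int[P]_w hn (X w))%E.
    by apply: eq_integral => w _; rewrite /hn !funenegE.
  by rewrite -E; apply: eq_integral => w _; rewrite /hp !funeposE.
exact: subee.
Qed.

End matrix_stein.

Section gaussian_moments.
Context (dT : measure_display) (T : measurableType dT) (R : realType).
Context (P : probability T R) (a b : nat) (X : {RV P >-> 'M[R]_(a, b)}).
Hypothesis gX : gaussian_matrix X.

(** The degrees 1 for [F] and 2 for [dF] are chosen so that every summand is dominated by
    [mx_size ^+ 2], which is integrable. *)
Lemma gaussian_divergence (F : 'M[R]_(a, b) -> 'M[R]_(b, a))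
    (dF : 'M[R]_(a, b) -> 'M[R]_(a, b) -> 'M[R]_(b, a)) :
  tame 1 F -> (forall D, mx_deriv D F (dF D)) -> (forall D, tame 2 (dF D)) ->
  let h (M : 'M[R]_(a, b)) := \sum_i \sum_j (M i j * F M j i - dF (delta_mx i j) M j i) in
  P.-integrable setT (fun w => (h (X w))%:E) /\
  (\int[P]_w (h (X w))%:E = 0)%E.
Proof.
move=> [[K K0 bF] mF _] FdF tdF h.
have key i j : P.-integrable setT (fun w =>
      (X w i j * F (X w) j i - dF (delta_mx i j) (X w) j i)%:E) /\
    (\int[P]_w (X w i j * F (X w) j i - dF (delta_mx i j) (X w) j i)%:E = 0)%E.
  have [[L L0 bdF] mdF ddF] := tdF (delta_mx i j).
  have s1 (M : 'M[R]_(a, b)) := mx_size_ge1 M.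
  have s0 (M : 'M[R]_(a, b)) := mx_size_gt0 M.
  have b1 (M : 'M[R]_(a, b)) : `|F M j i| <= (K + L) * mx_size M ^+ 2.
    apply: (le_trans (bF M j i)); rewrite expr1 mulrDl -[leLHS]addr0 lerD//.
      by rewrite ler_wpM2l// expr2 ler_peMl// ltW.
    by rewrite mulr_ge0// sqr_ge0.
  have b2 (M : 'M[R]_(a, b)) : `|M i j * F M j i| <= (K + L) * mx_size M ^+ 2.
    rewrite normrM mulrDl -[leLHS]addr0 lerD//; last by rewrite mulr_ge0// sqr_ge0.
    rewrite expr2 mulrA mulrC; apply: ler_pM => //; last exact: entry_le_mx_size.
  have b3 (M : 'M[R]_(a, b)) : `|dF (delta_mx i j) M j i| <= (K + L) * mx_size M ^+ 2.
    apply: (le_trans (bdF M j i)); rewrite mulrDl -[leLHS]add0r lerD//.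
    by rewrite mulr_ge0// sqr_ge0.
  split; last first.
    apply: (@gaussian_stein _ _ _ _ _ _ _ gX i j (fun M => F M j i)
      (fun M => dF (delta_mx i j) M j i) (K + L)) => //.
    by move=> M; exact: FdF.
  apply: (@integrable_dominated _ _ _ _ _ _ _ gX
    (fun M : 'M[R]_(a, b) => M i j * F M j i - dF (delta_mx i j) M j i) (2 * (K + L))).
    apply: measurable_funB; last exact: mdF.
    by apply: measurable_funM; [exact: measurable_mx_entry|exact: mF].
  move=> M; rewrite -mulrA mulr_natl mulr2n (le_trans (ler_normB _ _))//.
  exact: lerD.
have hE w : (h (X w))%:E = (\sum_i \sum_j
    (X w i j * F (X w) j i - dF (delta_mx i j) (X w) j i)%:E)%E.
  by rewrite /h -sumEFin; apply: eq_bigr => i _; rewrite -sumEFin.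
under [in X in _ /\ X]eq_integral do rewrite hE.
under eq_fun do rewrite hE.
split.
  apply: integrable_sum => // i _; apply: integrable_sum => // j _.
  by have [] := key i j.
rewrite integral_sum//; last first.
  by move=> i; apply: integrable_sum => // j _; have [] := key i j.
rewrite big1// => i _; rewrite integral_sum//; last by move=> j; have [] := key i j.
by rewrite big1// => j _; have [] := key i j.
Qed.

Context (q : nat) (Q : 'M[R]_(a, q)) (e : R).
Hypotheses (e0 : 0 < e) (QQ : Q^T *m Q = 1%:M) (qb : (q.+2 <= b)%N).
Local Notation M := (fun X => resolvent e (X^T *m Q)).
Local Notation W := (fun X => X^T *m Q *m resolvent e (X^T *m Q)).

Let c0 : 0 < b%:R - q%:R - 1 :> R.
Proof. by rewrite -addrA -opprD subr_gt0 natr1 ltr_nat. Qed.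

Lemma integrable_tr_resolvent :
  P.-integrable setT (fun w => (\tr (M (X w)))%:E).
Proof.
have [_ mM _] := @tame_resolvent R a b q Q e e0.
apply: (@integrable_dominated _ _ _ _ _ _ _ gX (fun X => \tr (M X)) (q%:R * e^-1)).
  exact: measurable_trace.
move=> Y; rewrite -[leLHS]mulr1 ler_pM//; last first.
  by rewrite -[leLHS](expr1n _ 2) ler_pXn2r ?nnegrE ?mx_size_ge1// ltW// mx_size_gt0.
rewrite (le_trans (ler_norm_sum _ _ _))//.
apply: (@le_trans _ _ (\sum_(i < q) e^-1)); last by rewrite sumr_const card_ord mulr_natl.
by apply: ler_sum => i _; exact: norm_resolvent_le.
Qed.

Lemma gaussian_tr_resolvent_le :
  (\int[P]_w (\tr (resolvent e ((X w)^T *m Q)))%:E <=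
   (q%:R / (b%:R - q%:R - 1))%:E)%E.
Proof.
have tF : tame 1 (fun X : 'M[R]_(a, b) => W X *m Q^T).
  apply: (tame_leq (leq0n 1)); apply: (tameM (k := 0) (l := 0)).
    exact: tame_gram_resolvent.
  exact: tame_cst.
have dF D : mx_deriv D (fun X : 'M[R]_(a, b) => W X *m Q^T)
    (fun X => dgram_resolvent Q e D X *m Q^T).
  move=> Y i j; have := mx_derivM (@mx_deriv_gram_resolvent R a b q Q e e0 D)
    (mx_deriv_cst D Q^T) Y i j.
  by rewrite mulmx0 addr0.
have tdF D : tame 2 (fun X : 'M[R]_(a, b) => dgram_resolvent Q e D X *m Q^T).
  have t1 : tame 1 (fun X : 'M[R]_(a, b) => dgram_resolvent Q e D X *m Q^T).
    exact: (tameM (k := 1) (l := 0) (tame_dW Q e0 D) (tame_cst a b Q^T)).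
  exact: (@tame_leq _ _ _ 1 2 _ _ _ _ t1).
have [ih h0] := gaussian_divergence tF dF tdF.
have iM := integrable_tr_resolvent.
have iub : P.-integrable setT (fun w =>
    (q%:R - (b%:R - q%:R - 1) * \tr (M (X w)))%:E).
  under eq_fun do rewrite EFinB EFinM.
  apply: integrableB => //; first exact: finite_measure_integrable_cst.
  exact: integrableZl.
have : (0 <= \int[P]_w (q%:R - (b%:R - q%:R - 1) * \tr (M (X w)))%:E)%E.
  rewrite -h0; apply: le_integral => // w _; rewrite lee_fin.
  exact: stein_resolvent_algebra.
under eq_integral do rewrite EFinB EFinM.
rewrite integralB//; [|exact: finite_measure_integrable_cst|exact: integrableZl].
rewrite integral_cst// [X in (_ * X - _)%E](probability_setT P) mule1 integralZl//.
have := integrable_fin_num measurableT iM.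
move: (\int[P]_w _)%E => [t| |]// _.
by rewrite -EFinM -EFinB !lee_fin subr_ge0 ler_pdivlMr// mulrC.
Qed.

Lemma gaussian_projection_le c (E : 'M[R]_(a, c)) : Q^T *m E = 0 ->
  (\int[P]_w (nsq (resolvent e ((X w)^T *m Q) *m ((X w)^T *m Q)^T *m (X w)^T *m E))%:E <=
   (nsq E * (q%:R / (b%:R - q%:R - 1)))%:E)%E.
Proof.
move=> QE; pose C := E *m E^T.
have tW := @tame_gram_resolvent R a b q Q e e0.
have tWT : tame 0 (fun X : 'M[R]_(a, b) => (W X)^T) by exact: tame_tr.
have tX (A : 'M[R]_a) : tame 1 (fun X : 'M[R]_(a, b) => X^T *m A).
  by apply: (tameM (k := 1) (l := 0)); [exact: tame_trid|exact: tame_cst].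
have tF : tame 1 (fun X : 'M[R]_(a, b) => W X *m ((W X)^T *m (X^T *m C))).
  by apply: (tameM (k := 0) (l := 1)) => //; apply: (tameM (k := 0) (l := 1)).
have dF D : mx_deriv D (fun X : 'M[R]_(a, b) => W X *m ((W X)^T *m (X^T *m C)))
    (fun X => dgram_resolvent Q e D X *m ((W X)^T *m (X^T *m C)) +
     W X *m ((dgram_resolvent Q e D X)^T *m (X^T *m C) + (W X)^T *m (D^T *m C))).
  have dWD := @mx_deriv_gram_resolvent R a b q Q e e0 D.
  exact: mx_derivM dWD (mx_derivM (mx_deriv_tr dWD) (mx_deriv_gram_arg D C)).
have tdF D : tame 2 (fun X : 'M[R]_(a, b) => dgram_resolvent Q e D X *m ((W X)^T *m (X^T *m C)) +
     W X *m ((dgram_resolvent Q e D X)^T *m (X^T *m C) + (W X)^T *m (D^T *m C))).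
  have tdW := tame_dW Q e0 D.
  have t1 : tame 2 (fun X : 'M[R]_(a, b) => dgram_resolvent Q e D X *m ((W X)^T *m (X^T *m C))).
    exact: (tameM (k := 1) (l := 1) tdW (tameM (k := 0) (l := 1) tWT (tX C))).
  have t2 : tame 2 (fun X : 'M[R]_(a, b) => (dgram_resolvent Q e D X)^T *m (X^T *m C)).
    exact: (tameM (k := 1) (l := 1) (tame_tr tdW) (tX C)).
  have t3 : tame 2 (fun X : 'M[R]_(a, b) => (W X)^T *m (D^T *m C)).
    have t0 : tame 0 (fun X : 'M[R]_(a, b) => (W X)^T *m (D^T *m C)).
      exact: (tameM (k := 0) (l := 0) tWT (tame_cst a b (D^T *m C))).
    exact: (@tame_leq _ _ _ 0 2 _ _ _ _ t0).
  exact: (tameD t1 (tameM (k := 0) (l := 2) tW (tameD t2 t3))).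
have [ih h0] := gaussian_divergence tF dF tdF.
pose g (Y : 'M[R]_(a, b)) := nsq ((W Y)^T *m Y^T *m E) - nsq (W Y) * nsq E.
have hE w : (\sum_i \sum_j (X w i j * (W (X w) *m ((W (X w))^T *m ((X w)^T *m C))) j i -
   (dgram_resolvent Q e (delta_mx i j) (X w) *m ((W (X w))^T *m ((X w)^T *m C)) +
     W (X w) *m ((dgram_resolvent Q e (delta_mx i j) (X w))^T *m ((X w)^T *m C) +
      (W (X w))^T *m ((delta_mx i j)^T *m C))) j i))%:E = (g (X w))%:E.
  by rewrite /g -(stein_projection_algebra e (X w) QE) /C !mulmxA.
have {h0}h0 : (\int[P]_w (g (X w))%:E = 0)%E.
  by rewrite -h0; apply: eq_integral => w _; rewrite hE.
have {}ih : P.-integrable setT (fun w => (g (X w))%:E).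
  by apply: eq_integrable ih => // w _; rewrite hE.
have iW : P.-integrable setT (fun w => (nsq (W (X w)) * nsq E)%:E).
  have iM := integrable_tr_resolvent.
  under eq_fun do rewrite mulrC EFinM.
  apply: integrableZl => //; apply: le_integrable iM => //.
    apply/measurable_EFinP.
    have [_ mW _] := tW; have mX : measurable_fun setT X := measurable_funPT X.
    exact: (measurableT_comp (measurable_nsq mW) mX).
  move=> w _; rewrite lee_fin !ger0_norm ?nsq_ge0 ?tr_resolvent_ge0//.
  exact: nsq_mul_resolvent_le.
have -> : (\int[P]_w (nsq (resolvent e ((X w)^T *m Q) *m ((X w)^T *m Q)^T *m (X w)^T *m E))%:E =
    \int[P]_w ((g (X w))%:E + (nsq (W (X w)) * nsq E)%:E))%E.
  apply: eq_integral => w _; rewrite /g -EFinD subrK.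
  by rewrite [in RHS]trmx_mul resolvent_tr.
rewrite integralD// h0 add0e EFinM.
apply: (@le_trans _ _ (\int[P]_w ((nsq E)%:E * (\tr (M (X w)))%:E))%E).
  apply: le_integral => //.
    by apply: integrableZl => //; exact: integrable_tr_resolvent.
  move=> w _; rewrite -EFinM lee_fin mulrC ler_wpM2l ?nsq_ge0//.
  exact: nsq_mul_resolvent_le.
rewrite integralZl//; last exact: integrable_tr_resolvent.
by rewrite lee_wpmul2l ?lee_fin ?nsq_ge0//; exact: gaussian_tr_resolvent_le.
Qed.

End gaussian_moments.

(** * Expected error of the sketches *)

Section resolvent_sequence.
Context (R : realType).

Definition mx_cvg p q (f : nat -> 'M[R]_(p, q)) (L : 'M[R]_(p, q)) :=
  forall i j, f n i j @[n --> \oo] --> L i j.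

Lemma mx_cvg_mulr p q r (f : nat -> 'M[R]_(p, q)) L (C : 'M[R]_(q, r)) :
  mx_cvg f L -> mx_cvg (fun n => f n *m C) (L *m C).
Proof.
move=> fL i j; under eq_fun do rewrite mxE; rewrite mxE.
apply: (@cvg_big _ _ +%R 0 xpredT) => [|k _]; first exact: add_continuous.
by apply: cvgM; [exact: fL|exact: cvg_cst].
Qed.

Lemma mx_cvg_nsq p q (f : nat -> 'M[R]_(p, q)) L :
  mx_cvg f L -> nsq (f n) @[n --> \oo] --> nsq L.
Proof.
move=> fL; under eq_fun do rewrite nsqE; rewrite nsqE.
apply: (@cvg_big _ _ +%R 0 xpredT) => [|i _]; first exact: add_continuous.
apply: (@cvg_big _ _ +%R 0 xpredT) => [|j _]; first exact: add_continuous.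
by under eq_fun do rewrite expr2; rewrite expr2; apply: cvgM.
Qed.

Lemma moore_penrose_cvg p q (G : 'M[R]_(p, q)) :
  mx_cvg (fun n => resolvent n.+1%:R^-1 G *m G^T) (moore_penrose G).
Proof.
move=> i j; have [K KP] := moore_penrose_resolvent_bound G.
apply/cvgrPdist_le => eta eta0; near=> n.
apply: (le_trans (KP _ i j _)); first by rewrite invr_gt0.
apply: (@le_trans _ _ (`|K| * n.+1%:R^-1)).
  by rewrite ler_wpM2r ?invr_ge0// ler_norm.
rewrite ler_pdivrMr// mulrC -ler_pdivrMr//.
near: n; exists (Num.trunc (`|K| / eta)) => // n /= xn.
by rewrite ltW// (lt_le_trans (truncnS_gt _))// ler_nat ltnS.
Unshelve. all: by end_near. Qed.

Lemma limn_einf_ge (u : nat -> R) (c : R) :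
  (forall eta, 0 < eta -> \forall n \near \oo, c - eta <= u n) ->
  (c%:E <= limn_einf (EFin \o u))%E.
Proof.
move=> cu; apply/lee_subgt0Pr => eta eta0; rewrite limn_einf_lim.
have [N _ NP] := cu _ eta0.
apply: lime_ge; first exact: is_cvg_einfs.
exists N => // n /= Nn; apply: le_ereal_inf_tmp => _ [k /= nk <-] /=.
by rewrite -EFinB lee_fin; apply: NP; exact: leq_trans nk.
Qed.

Lemma limn_einf_le (u : nat -> \bar R) (c : \bar R) :
  (forall n, (u n <= c)%E) -> (limn_einf u <= c)%E.
Proof.
move=> uc; rewrite limn_einf_lim; apply: lime_le; first exact: is_cvg_einfs.
by apply: nearW => n; apply: le_trans (uc n); apply: ereal_inf_lbound; exists n => //=.
Qed.

End resolvent_sequence.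

(** The pseudoinverse is discontinuous where the rank drops; measurability passes to it as a
    pointwise limit of regularized inverses. *)
Lemma mx_meas_moore_penrose (R : realType) (dT : measure_display)
    (T : measurableType dT) p q (f : T -> 'M[R]_(p, q)) :
  mx_meas f -> mx_meas (fun w => moore_penrose (f w)).
Proof.
move=> mf i j.
apply: (@measurable_fun_cvg _ _ _ setT
  (fun n w => (resolvent n.+1%:R^-1 (f w) *m (f w)^T) i j)).
  move=> n; have : mx_meas (fun w => resolvent n.+1%:R^-1 (f w) *m (f w)^T).
    apply: mx_measM; last exact: mx_meas_tr.
    by apply: mx_meas_resolvent => //; rewrite invr_gt0.
  exact.
by move=> w _; exact: moore_penrose_cvg.
Qed.

Lemma measurable_nystrom_error (R : realType) (dT : measure_display)
    (T : measurableType dT) m n k s (B : T -> 'M[R]_(m, n))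
    (O : T -> 'M[R]_(n, k)) (Y : T -> 'M[R]_(m, s)) :
  mx_meas B -> mx_meas O -> mx_meas Y ->
  measurable_fun setT (fun w => nsq ((1%:M - nystrom_proj (B w) (O w) (Y w)) *m B w)).
Proof.
move=> mB mO mY; apply: measurable_nsq; apply: mx_measM => //.
apply: mx_measD; first exact: mx_meas_cst.
have mBO := mx_measM mB mO; apply: mx_measN; apply: mx_measM; last exact: mx_meas_tr.
apply: mx_measM => //; apply: mx_meas_moore_penrose; apply: mx_measM => //.
exact: mx_meas_tr.
Qed.

Section gaussian_sketch.
Context (dT : measure_display) (T : measurableType dT) (R : realType).
Context (P : probability T R).

Lemma rowNfull_ker p q (G : 'M[R]_(p, q)) : ~~ row_full G ->
  exists2 x : 'cV[R]_q, x != 0 & G *m x = 0.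
Proof.
rewrite /row_full -mxrank_tr -/(row_free G^T) -kermx_eq0 => /rowV0Pn[x].
move=> /sub_kermxP xG x0; exists x^T; first by rewrite trmx_eq0.
by rewrite -[G]trmxK -trmx_mul xG trmx0.
Qed.

(* Where Psi^T Q is rank deficient the trace of the regularized inverse Gram
   matrix tends to infinity, so that adding a small multiple of it makes the
   limiting bound valid everywhere. *)
Lemma gaussian_left_sketch m n k l (Psi : {RV P >-> 'M[R]_(m, k + l)})
    (B : 'M[R]_(m, n)) (O : 'M[R]_(n, k)) (C : 'M[R]_(k, n)) :
  gaussian_matrix Psi -> (2 <= l)%N ->
  (\int[P]_w (nsq ((1%:M - nystrom_proj B O (Psi w)) *m B))%:E <=
   ((1 + k%:R / (l%:R - 1)) * nsq (B - B *m O *m C))%:E)%E.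
Proof.
move=> gPsi l2.
have [q [Q [Z [qk QQ YQ QY]]]] := orthonormal_range_basis (B *m O).
have [E EE] : exists E, E = (1%:M - Q *m Q^T) *m B by eexists.
have QE : Q^T *m E = 0.
  by rewrite EE mulmxA mulmxBr mulmx1 mulmxA QQ mul1mx subrr mul0mx.
have qkl : (q.+2 <= k + l)%N by rewrite -addn2 leq_add.
have l1 : 0 < l%:R - 1 :> R by rewrite subr_gt0 ltr1n.
pose c : R := q%:R / ((k + l)%:R - q%:R - 1).
have c0 : 0 <= c.
  rewrite divr_ge0// -addrA -opprD subr_ge0 natr1 ler_nat.
  exact: ltnW.
(* From [q <= k] the numerator is at most [k] and the denominator at least [l - 1]. *)
have cle : c <= k%:R / (l%:R - 1).
  have kq : q%:R <= k%:R :> R by rewrite ler_nat.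
  rewrite /c natrD ler_pM ?invr_ge0 ?lef_pV2 ?posrE//; lra.
apply: (@le_trans _ _ ((1 + c) * nsq E)%:E); last first.
  rewrite lee_fin ler_pM ?nsq_ge0 ?addr_ge0// ?lerD2l//.
  by rewrite EE; exact: nsq_range_residual_le.
apply/lee_addgt0Pr => eta eta0; rewrite -EFinD.
(* Chosen so that [delta * c <= eta]; the 1 keeps the quotient defined when [c = 0]. *)
pose delta := eta / (c + 1).
have delta0 : 0 < delta by rewrite divr_gt0// ltr_wpDl.
have mPsi : mx_meas (fun w => Psi w).
  by apply/measurable_fun_mxP; exact: measurable_funPT.
have mG : mx_meas (fun w => (Psi w)^T *m Q).
  by apply: mx_measM; [exact: mx_meas_tr|exact: mx_meas_cst].
pose M N w := resolvent N.+1%:R^-1 ((Psi w)^T *m Q).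
pose V N w := M N w *m ((Psi w)^T *m Q)^T *m (Psi w)^T *m E.
have mM N : mx_meas (M N) by apply: mx_meas_resolvent => //; rewrite invr_gt0.
have mV N : mx_meas (V N).
  by do 3![apply: mx_measM => //; try exact: mx_meas_tr]; exact: mx_meas_cst.
pose h N w : R := nsq E + (nsq (V N w) + delta * \tr (M N w)).
have tr0 N w : 0 <= \tr (M N w) by rewrite tr_resolvent_ge0// invr_gt0.
have h0 N w : 0 <= h N w by rewrite !addr_ge0 ?nsq_ge0// mulr_ge0// ltW.
have mh1 N : measurable_fun setT (fun w => nsq (V N w)) by exact: measurable_nsq.
have mh2 N : measurable_fun setT (fun w => \tr (M N w)) by exact: measurable_trace.
have mh N : measurable_fun setT (h N).
  by apply: measurable_funD => //; apply: measurable_funD => //; exact: measurable_funM.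
have Fh w : ((nsq ((1%:M - nystrom_proj B O (Psi w)) *m B))%:E <=
    limn_einf (fun N => (h N w)%:E))%E.
  apply: limn_einf_ge => eps eps0.
  have [full|/rowNfull_ker[x x0 Gx]] := boolP (row_full ((Psi w)^T *m Q)).
    rewrite (nsq_nystrom_error QQ YQ QY full) -EE.
    have : nsq (V N w) @[N --> \oo] -->
        nsq (moore_penrose ((Psi w)^T *m Q) *m (Psi w)^T *m E).
      apply: mx_cvg_nsq; rewrite -mulmxA /V.
      under eq_fun do rewrite -(mulmxA _ (Psi w)^T).
      by apply: mx_cvg_mulr; exact: moore_penrose_cvg.
    move=> /cvgrPdist_le/(_ _ eps0); apply: filterS => N.
    rewrite ler_norml => /andP[_ hN]; rewrite /h -addrA lerD2l.
    have := mulr_ge0 (ltW delta0) (tr0 N w); lra.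
  set F := nsq _.
  (* In the rank-deficient case [tr (M N w) >= N + 1], so [delta] times the trace eventually exceeds
     the fixed error [F]. *)
  near=> N; rewrite lerBlDr (@le_trans _ _ (delta * N.+1%:R))//; last first.
    have N0 : 0 < (N.+1%:R^-1 : R) by rewrite invr_gt0.
    have := tr_resolvent_ge_of_ker N0 x0 Gx; rewrite invrK -/(M N w) => hN.
    have : delta * N.+1%:R <= delta * \tr (M N w) by rewrite ler_pM2l.
    have := nsq_ge0 E; have := nsq_ge0 (V N w); rewrite /h; lra.
  rewrite mulrC -ler_pdivrMr//.
  near: N; exists (Num.trunc (F / delta)) => // N /= xN.
  by rewrite ltW// (lt_le_trans (truncnS_gt _))// ler_nat ltnS.
have mF : measurable_fun setT (fun w => (nsq ((1%:M - nystrom_proj B O (Psi w)) *m B))%:E).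
  apply/measurable_EFinP; apply: measurable_nystrom_error => //; exact: mx_meas_cst.
have mEh N : measurable_fun setT (fun w => (h N w)%:E) by exact/measurable_EFinP.
apply: (@le_trans _ _ (\int[P]_w limn_einf (fun N => (h N w)%:E))%E).
  apply: ge0_le_integral => //.
  - by move=> w _; rewrite lee_fin nsq_ge0.
  - rewrite /limn_einf; apply: measurableT_comp => //.
    by apply: measurable_fun_limn_esup => N; exact: measurableT_comp.
have hge0 N w : setT w -> (0 <= (h N w)%:E)%E by rewrite lee_fin.
apply: (le_trans (@fatou _ _ _ P setT measurableT (fun N w => (h N w)%:E) mEh hge0)).
apply: limn_einf_le => N.
under eq_integral do rewrite !EFinD EFinM.
have m1 : measurable_fun setT (fun w => (nsq (V N w))%:E) by exact/measurable_EFinP.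
have m2 : measurable_fun setT (fun w => (\tr (M N w))%:E) by exact/measurable_EFinP.
have m3 : measurable_fun setT (fun w => delta%:E * (\tr (M N w))%:E)%E by exact: measurable_funeM.
have p1 w : (0 <= (nsq (V N w))%:E)%E by rewrite lee_fin nsq_ge0.
have p3 w : (0 <= delta%:E * (\tr (M N w))%:E)%E by rewrite mule_ge0 ?lee_fin// ltW.
rewrite ge0_integralD//; last 3 first.
- by move=> *; rewrite lee_fin nsq_ge0.
- by move=> w _; rewrite adde_ge0.
- exact: emeasurable_funD.
rewrite ge0_integralD// ge0_integralZl//; [|by move=> w _; rewrite lee_fin|by rewrite lee_fin ltW].
rewrite integral_cst// [X in (_ * X + _)%E](probability_setT P) mule1.
have N0 : 0 < (N.+1%:R^-1 : R) by rewrite invr_gt0.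
have b1 := gaussian_projection_le gPsi N0 QQ qkl QE.
have b2 := gaussian_tr_resolvent_le gPsi N0 QQ qkl.
have b3 : (delta%:E * \int[P]_w (\tr (M N w))%:E <= (delta * c)%:E)%E.
  by rewrite [leRHS]EFinM lee_wpmul2l// lee_fin ltW.
apply: (@le_trans _ _ ((nsq E)%:E + ((nsq E * c)%:E + (delta * c)%:E))%E).
  by rewrite leeD2l// leeD.
rewrite -!EFinD lee_fin.
have : delta * c <= eta.
  rewrite /delta mulrAC ler_pdivrMr ?ltr_wpDl// ler_pM2l// lerDl//.
lra.
Unshelve. all: by end_near. Qed.

End gaussian_sketch.

(* Holds for any span V of eigenvectors of B^T B, since then B V and E^T have
   orthogonal columns. *)
Lemma nsq_right_sketch (R : realType) m n k q (B : 'M[R]_(m, n)) (V : 'M[R]_(n, q))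
    (L : 'M[R]_q) (O : 'M[R]_(n, k)) (e : R) :
  0 < e -> V^T *m V = 1%:M -> B^T *m B *m V = V *m L ->
  let G := O^T *m V in let W := G *m resolvent e G in
  let E := (1%:M - V *m V^T) *m B^T in
  nsq (B - B *m O *m (W *m V^T)) =
  nsq E + (e ^+ 2 * nsq (B *m V *m resolvent e G) +
           nsq (resolvent e G *m G^T *m O^T *m E)).
Proof.
move=> e0 VV BV; have [G GE] : exists G, G = O^T *m V by eexists.
have [M ME] : exists M, M = resolvent e G by eexists.
have [W WE] : exists W, W = G *m M by eexists.
have [E EE] : exists E, E = (1%:M - V *m V^T) *m B^T by eexists.
rewrite /= -GE -ME -WE -EE.
have VE : V^T *m E = 0.
  by rewrite EE mulmxA mulmxBr mulmx1 mulmxA VV mul1mx subrr mul0mx.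
have ET : E^T = B - B *m V *m V^T.
  rewrite EE mulmxBl mul1mx [(_ - _)^T]linearB/= trmxK !trmx_mul !trmxK.
  by rewrite mulmxA.
have GT : G^T = V^T *m O by rewrite GE trmx_mul trmxK.
have GW : G^T *m W = 1%:M - e *: M.
  by rewrite WE mulmxA ME gram_mul_resolvent.
have BO : B *m O = B *m V *m G^T + E^T *m O.
  by rewrite ET GT mulmxBl !mulmxA addrC subrK.
(* The error along [V]: the bias [e B V M] of the regularized inverse minus the noise [E^T O W] from
   the remaining directions. *)
have [U UE] : exists U, U = e *: (B *m V *m M) - E^T *m O *m W by eexists.
have -> : B - B *m O *m (W *m V^T) = U *m V^T + E^T.
  have BOW : B *m O *m W = B *m V - U.
    by rewrite BO mulmxDl -mulmxA GW mulmxBr mulmx1 -scalemxAr UE opprB addrA addrAC.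
  by rewrite mulmxA BOW mulmxBl ET opprB addrCA.
have nU : nsq U = e ^+ 2 * nsq (B *m V *m M) + nsq (M *m G^T *m O^T *m E).
  rewrite UE nsqD_orth ?nsqN ?nsqZ.
    congr (_ + _); rewrite -[LHS]nsqT !trmx_mul trmxK WE trmx_mul ME resolvent_tr.
    by rewrite !mulmxA.
  rewrite mulmxN [(_ *: _)^T]linearZ/= -scalemxAl !trmx_mul.
  (* Invariance of the span of [V] enters here: [E B V = (1 - V V^T) V L = 0], so bias and noise are
     orthogonal. *)
  have VBE : V^T *m B^T *m E^T = 0.
    have -> : V^T *m B^T *m E^T = (E *m (B *m V))^T by rewrite !trmx_mul.
    rewrite EE -!mulmxA (mulmxA B^T) BV mulmxBl mul1mx -mulmxA (mulmxA V^T) VV.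
    by rewrite mul1mx subrr trmx0.
  by rewrite -!mulmxA (mulmxA V^T) (mulmxA (V^T *m B^T)) VBE mul0mx mulmx0 scaler0 oppr0.
rewrite -nsqT [(_ + _)^T]linearD/= trmxK trmx_mul trmxK nsqD_orth; last first.
  by rewrite trmx_mul trmxK -mulmxA VE mulmx0.
by rewrite (nsq_mul_orth _ VV) nsqT nU addrC.
Qed.

Section gaussian_right_sketch.
Context (dT : measure_display) (T : measurableType dT) (R : realType).
Context (P : probability T R).

(** [C] uses one fixed [e], so no limit is taken. The bias [e^2 |B V M|^2] is at most
    [e |B V|^2 tr M], whose expectation is made at most [eta]. Measurability of [C] is recorded for
    the later integration over [Om]. *)
Lemma gaussian_right_sketch m n r k (Om : {RV P >-> 'M[R]_(n, k)})
    (B : 'M[R]_(m, n)) (eta : R) :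
  gaussian_matrix Om -> (r.+2 <= k)%N -> 0 < eta ->
  exists2 C : 'M[R]_(n, k) -> 'M[R]_(k, n), mx_meas C &
  (\int[P]_w (nsq (B - B *m Om w *m C (Om w)))%:E <=
   ((1 + r%:R / (k%:R - r%:R - 1)) *
    \sum_(r <= j < minn m n) (singular_values B)`_j ^+ 2 + eta)%:E)%E.
Proof.
move=> gOm rk eta0; set tau := \sum_(_ <= _ < _) _.
have [q [V [L [qr VV BV tauE]]]] := top_right_singular_vectors B r.
have [E EE] : exists E, E = (1%:M - V *m V^T) *m B^T by eexists.
rewrite -EE -/tau in tauE.
have VE : V^T *m E = 0.
  by rewrite EE mulmxA mulmxBr mulmx1 mulmxA VV mul1mx subrr mul0mx.
have qk : (q.+2 <= k)%N by exact: leq_trans rk.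
pose c : R := q%:R / (k%:R - q%:R - 1).
have kr : r%:R + 1 < k%:R :> R by rewrite natr1 ltr_nat.
have qr' : q%:R <= r%:R :> R by rewrite ler_nat.
have c0 : 0 <= c by rewrite divr_ge0//; lra.
have cle : c <= r%:R / (k%:R - r%:R - 1).
  by rewrite /c ler_pM ?invr_ge0 ?lef_pV2 ?posrE//; lra.
(* The expected bias is at most [e * nsq (B *m V) * c], so [e = eta / d] suffices; the 1 keeps [d]
   positive. *)
pose d := nsq (B *m V) * c + 1.
have d0 : 0 < d by rewrite ltr_wpDl// mulr_ge0// nsq_ge0.
have [e eE] : exists e, e = eta / d by eexists.
have e0 : 0 < e by rewrite eE divr_gt0.
pose C (O : 'M[R]_(n, k)) := O^T *m V *m resolvent e (O^T *m V) *m V^T.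
have mid : mx_meas (fun O : 'M[R]_(n, k) => O) by move=> i j; exact: measurable_mx_entry.
have mG : mx_meas (fun O : 'M[R]_(n, k) => O^T *m V).
  by apply: mx_measM; [exact: mx_meas_tr|exact: mx_meas_cst].
have mM : mx_meas (fun O : 'M[R]_(n, k) => resolvent e (O^T *m V)).
  exact: mx_meas_resolvent.
exists C; first by apply: mx_measM; [exact: mx_measM|exact: mx_meas_cst].
have mOm : measurable_fun setT Om by exact: measurable_funPT.
pose t w := \tr (resolvent e ((Om w)^T *m V)).
pose g w := nsq (resolvent e ((Om w)^T *m V) *m ((Om w)^T *m V)^T *m (Om w)^T *m E).
have mt : measurable_fun setT (fun w => (t w)%:E).
  apply/measurable_EFinP; exact: (measurableT_comp (measurable_trace mM) mOm).
have mg' : mx_meas (fun O : 'M[R]_(n, k) =>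
    resolvent e (O^T *m V) *m (O^T *m V)^T *m O^T *m E).
  by do 3![apply: mx_measM => //; try exact: mx_meas_tr]; exact: mx_meas_cst.
have mg : measurable_fun setT (fun w => (g w)%:E).
  by apply/measurable_EFinP; exact: (measurableT_comp (measurable_nsq mg') mOm).
have t0 w : (0 <= (t w)%:E)%E by rewrite lee_fin tr_resolvent_ge0.
have g0 w : (0 <= (g w)%:E)%E by rewrite lee_fin nsq_ge0.
have le w : nsq (B - B *m Om w *m C (Om w)) <=
    nsq E + (e * nsq (B *m V) * t w + g w).
  rewrite /C (@nsq_right_sketch R m n k q B V L (Om w) e e0 VV BV) -EE lerD2l lerD2r.
  rewrite expr2 -!mulrA ler_pM2l//.
  rewrite (le_trans (ler_wpM2l (ltW e0) (nsq_mul_le _ _)))// mulrCA.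
  by rewrite ler_wpM2l ?nsq_ge0// nsq_resolvent_le.
have a0 : 0 <= e * nsq (B *m V) by rewrite mulr_ge0 ?nsq_ge0// ltW.
have p1 w : (0 <= (e * nsq (B *m V))%:E * (t w)%:E)%E.
  by apply: mule_ge0; rewrite ?lee_fin //; exact: t0.
have m1 : measurable_fun setT (fun w => (e * nsq (B *m V))%:E * (t w)%:E)%E.
  exact: measurable_funeM.
have mF : measurable_fun setT (fun w => (nsq (B - B *m Om w *m C (Om w)))%:E).
  have mR : mx_meas (fun O : 'M[R]_(n, k) => B - B *m O *m C O).
    apply: mx_measD; first exact: mx_meas_cst.
    apply: mx_measN; apply: mx_measM; last first.
      by apply: mx_measM; [exact: mx_measM|exact: mx_meas_cst].
    by apply: mx_measM => //; exact: mx_meas_cst.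
  by apply/measurable_EFinP; exact: (measurableT_comp (measurable_nsq mR) mOm).
apply: (@le_trans _ _ (\int[P]_w ((nsq E)%:E +
    ((e * nsq (B *m V))%:E * (t w)%:E + (g w)%:E)))%E).
  apply: ge0_le_integral => //.
  - by move=> w _; rewrite lee_fin nsq_ge0.
  - by apply: emeasurable_funD => //; exact: emeasurable_funD.
  - by move=> w _; rewrite -EFinM -!EFinD lee_fin.
rewrite ge0_integralD//; last 3 first.
- by move=> *; rewrite lee_fin nsq_ge0.
- by move=> w _; rewrite adde_ge0.
- exact: emeasurable_funD.
rewrite ge0_integralD// ge0_integralZl//.
rewrite integral_cst// [X in (_ * X + _)%E](probability_setT P) mule1.
have b1 := gaussian_projection_le gOm e0 VV qk VE.
have b2 := gaussian_tr_resolvent_le gOm e0 VV qk.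
have b3 : ((e * nsq (B *m V))%:E * \int[P]_w (t w)%:E <=
    (e * nsq (B *m V))%:E * c%:E)%E.
  by rewrite lee_wpmul2l// lee_fin.
apply: (@le_trans _ _ ((nsq E)%:E + ((e * nsq (B *m V))%:E * c%:E + (nsq E * c)%:E))%E).
  by rewrite leeD2l// leeD.
rewrite -EFinM -!EFinD lee_fin.
have h1 : e * nsq (B *m V) * c <= eta.
  rewrite eE -[leLHS]mulrA mulrAC ler_pdivrMr// ler_pM2l// /d; lra.
have h2 : (1 + c) * nsq E <= (1 + r%:R / (k%:R - r%:R - 1)) * tau.
  by rewrite ler_pM ?nsq_ge0 ?addr_ge0// lerD2l.
lra.
Qed.

End gaussian_right_sketch.

(** * Independence and measurability on Euclidean space *)

Section independence.
Context (dT : measure_display) (T : measurableType dT) (R : realType).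
Context (P : probability T R) d1 d2 (T1 : measurableType d1) (T2 : measurableType d2).

(** Independence identifies the joint law with the product of the marginal laws, and Tonelli's
    theorem does the rest. *)
Lemma ge0_integral_independent (X : {RV P >-> T1}) (Y : {RV P >-> T2})
    (f : T1 * T2 -> \bar R) : independent_RVs X Y ->
  measurable_fun setT f -> (forall z, 0 <= f z)%E ->
  (\int[P]_w f (X w, Y w) = \int[P]_w \int[P]_v f (X w, Y v))%E.
Proof.
move=> XY mf f0.
have mX : measurable_fun setT X by exact: measurable_funPT.
have mY : measurable_fun setT Y by exact: measurable_funPT.
have mXY : measurable_fun setT (fun w => (X w, Y w)) by exact/measurable_fun_pairP.
have [nu nuE] := pushforward_measure_ex P mXY.
transitivity (\int[nu]_z f z)%E.
  by rewrite nuE (ge0_integral_pushforward mXY).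
transitivity (\int[(distribution P X \x distribution P Y)%E]_z f z)%E.
  apply: eq_measure_integral => A mA _; apply/esym.
  apply: product_measure_unique => // A1 A2 mA1 mA2.
  by rewrite nuE; exact: XY.
rewrite fubini_tonelli1//.
rewrite ge0_integral_distribution//; last 2 first.
- exact: measurable_fun_fubini_tonelli_F.
- by move=> x; exact: integral_ge0.
apply: eq_integral => w _ /=; rewrite /fubini_F ge0_integral_distribution//.
exact: measurableT_comp.
Qed.

End independence.

Section row_vector_measurability.
Context (R : realType) (d : nat).

Definition rational_box (z : 'rV[rat]_d * nat) : set 'rV[R]_d :=
  [set v | forall j, `|v 0 j - ratr (z.1 0 j)| < z.2.+1%:R^-1].

Lemma measurable_rational_box z : measurable (rational_box z).
Proof.
rewrite (_ : rational_box z = \bigcap_(j in [set: 'I_d])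
  ((fun v : 'rV[R]_d => v 0 j) @^-1`
    `](ratr (z.1 0 j) - z.2.+1%:R^-1), (ratr (z.1 0 j) + z.2.+1%:R^-1)[)).
  apply: fin_bigcap_measurable => // j _; rewrite -[X in measurable X]setTI.
  by apply: measurable_mx_entry => //; exact: measurable_itv.
apply/seteqP; split => v h j; first by move=> _ /=; rewrite in_itv/= -ltr_distl; exact: h.
by have := h j I; rewrite /= in_itv/= -ltr_distl.
Qed.

(** The sigma-algebra is generated by coordinates, so an open set has to be exhibited as a countable
    union of boxes: those with rational centre and radius [1 / (k + 1)] that it contains. *)
Lemma open_measurable_rV (U : set 'rV[R]_d) : open U -> measurable U.
Proof.
move=> oU; rewrite (_ : U = \bigcup_z
  (if `[< rational_box z `<=` U >] then rational_box z else set0)).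
  apply: countable_bigcupT_measurable => // z; case: ifP => // _.
  exact: measurable_rational_box.
apply/seteqP; split => [x Ux|x [z _]]; last by case: ifPn => // /asboolP; apply.
have /nbhs_ballP[e /= e0 xe] : nbhs x U by exact: open_nbhs_nbhs.
(* A box of radius at most [e / 2] that contains [x] lies in the ball of radius [e] around [x]. *)
pose k := Num.trunc (2 / e).
have k0 : 0 < k.+1%:R^-1 :> R by rewrite invr_gt0.
have ke : k.+1%:R^-1 * 2 <= e.
  rewrite mulrC ler_pdivrMr// -ler_pdivrMl// mulrC ltW//.
  by rewrite (lt_le_trans (truncnS_gt _)).
have [c cP] : exists c : 'rV[rat]_d, forall j, `|x 0 j - ratr (c 0 j)| < k.+1%:R^-1.
  have {}cP j : exists q : rat, `|x 0 j - ratr q| < k.+1%:R^-1.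
    have : x 0 j - k.+1%:R^-1 < x 0 j + k.+1%:R^-1 by rewrite ltrD2l gtrN.
    move=> /rat_in_itvoo[q]; rewrite in_itv/= => qx; exists q.
    by rewrite distrC ltr_distl.
  have [c cP'] := choice cP.
  by exists (\row_j c j) => j; rewrite mxE.
exists (c, k) => //; rewrite asboolT; first by move=> j; exact: cP.
move=> v vc; apply: xe; split => // i j; rewrite ord1 -ball_normE /ball_/=.
rewrite (lt_le_trans _ ke)// mulr_natr mulr2n -(subrKA (ratr (c 0 j))).
by rewrite (le_lt_trans (ler_normD _ _))// ltrD// distrC; exact: vc.
Qed.

Lemma compact_measurable_rV (D : set 'rV[R]_d) : compact D -> measurable D.
Proof.
move=> cD; rewrite -(setCK D); apply: measurableC; apply: open_measurable_rV.
by apply: closed_openC; apply: compact_closed => //; exact: norm_hausdorff.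
Qed.

Lemma within_continuous_measurable_rV (D : set 'rV[R]_d) (f : 'rV[R]_d -> R) :
  measurable D -> {within D, continuous f} -> measurable_fun D f.
Proof.
move=> mD /continuousP cf; apply: (measurability _ (RGenOpens.measurableE R)).
move=> _ [_ [a [b ->] <-]].
have /open_subspaceP[V oV VD] : open (f @^-1` `]a, b[ : set (subspace D)).
  exact/cf/interval_open.
by rewrite setIC -VD; apply: measurableI => //; exact: open_measurable_rV.
Qed.

End row_vector_measurability.

(* No measurability is needed: the integral of a nonnegative function is a
   supremum over the simple functions below it. *)
Lemma ge0_le_lower_integral d (T : measurableType d) (R : realType)
    (mu : {measure set T -> \bar R}) (f g : T -> \bar R) :
  (forall x, 0 <= f x)%E -> (forall x, f x <= g x)%E ->
  (\int[mu]_x f x <= \int[mu]_x g x)%E.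
Proof.
move=> f0 fg; have g0 x : (0 <= g x)%E by exact: le_trans (fg x).
rewrite !ge0_integralTE//; apply: le_ereal_sup => _ [h hf <-].
by exists h => // x; exact: le_trans (fg x).
Qed.

Section expected_error.
Context (dT : measure_display) (T : measurableType dT) (R : realType).
Context (P : probability T R) (m n r p l : nat).
Context (Om : {RV P >-> 'M[R]_(n, r + p)}) (Psi : {RV P >-> 'M[R]_(m, r + p + l)}).
Hypotheses (gOm : gaussian_matrix Om) (gPsi : gaussian_matrix Psi).
Hypotheses (OmPsi : independent_RVs Om Psi) (p2 : (2 <= p)%N) (l2 : (2 <= l)%N).

(** For fixed [Om] the left-sketch bound holds with any coefficient matrix, in particular with
    [C (Om w)]. Integrating over [Om] then leaves the quantity that the right sketch estimates. *)
Lemma expected_nystrom_error (B : 'M[R]_(m, n)) :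
  (\int[P]_w (nsq ((1%:M - nystrom_proj B (Om w) (Psi w)) *m B))%:E <=
   ((1 + (r + p)%:R / (l%:R - 1)) * (1 + r%:R / (p%:R - 1)) *
    \sum_(r <= j < minn m n) (singular_values B)`_j ^+ 2)%:E)%E.
Proof.
set c := 1 + _ / (l%:R - 1); set tau := \sum_(_ <= _ < _) _.
have c0 : 0 < c.
  by rewrite ltr_wpDr// divr_ge0// subr_ge0 ler1n (ltn_trans _ l2).
apply/lee_addgt0Pr => eta eta0; rewrite -EFinD.
have rp : (r.+2 <= r + p)%N by rewrite -addn2 leq_add2l.
(* The right-sketch bound is later multiplied by [c], so its slack is [eta / c]. *)
have eta' : 0 < eta / c by rewrite divr_gt0.
have [C mC CP] := gaussian_right_sketch B gOm rp eta'.
pose f (z : 'M[R]_(n, r + p) * 'M[R]_(m, r + p + l)) :=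
  (nsq ((1%:M - nystrom_proj B z.1 z.2) *m B))%:E.
have mfst : mx_meas (fun z : 'M[R]_(n, r + p) * 'M[R]_(m, r + p + l) => z.1).
  by move=> i j; exact: (measurableT_comp (measurable_mx_entry i j) measurable_fst).
have msnd : mx_meas (fun z : 'M[R]_(n, r + p) * 'M[R]_(m, r + p + l) => z.2).
  by move=> i j; exact: (measurableT_comp (measurable_mx_entry i j) measurable_snd).
have mf : measurable_fun setT f.
  by apply/measurable_EFinP; apply: measurable_nystrom_error => //; exact: mx_meas_cst.
have f0 z : (0 <= f z)%E by rewrite lee_fin nsq_ge0.
rewrite -[leLHS]/(\int[P]_w f (Om w, Psi w))%E (ge0_integral_independent OmPsi)//.
have mOm : measurable_fun setT Om by exact: measurable_funPT.
have mPsi : measurable_fun setT Psi by exact: measurable_funPT.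
have mOP : measurable_fun setT (fun z : T * T => f (Om z.1, Psi z.2)).
  apply: measurableT_comp => //; apply/measurable_fun_pairP; split.
    exact: (measurableT_comp mOm measurable_fst).
  exact: (measurableT_comp mPsi measurable_snd).
have mR : mx_meas (fun O : 'M[R]_(n, r + p) => B - B *m O *m C O).
  apply: mx_measD; first exact: mx_meas_cst.
  apply: mx_measN; apply: mx_measM => //; apply: mx_measM.
    exact: mx_meas_cst.
  by move=> i j; exact: measurable_mx_entry.
have mRO : measurable_fun setT (fun w => (nsq (B - B *m Om w *m C (Om w)))%:E).
  by apply/measurable_EFinP; exact: (measurableT_comp (measurable_nsq mR) mOm).
apply: (@le_trans _ _ (\int[P]_w (c%:E * (nsq (B - B *m Om w *m C (Om w)))%:E))%E).
  apply: ge0_le_integral => //.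
  - by move=> w _; exact: integral_ge0.
  - exact: (@measurable_fun_fubini_tonelli_F _ _ _ _ _ P _ mOP).
  - exact: measurable_funeM.
  - by move=> w _; rewrite -EFinM; exact: gaussian_left_sketch.
rewrite ge0_integralZl//; last 2 first.
- by move=> w _; rewrite lee_fin nsq_ge0.
- by rewrite lee_fin ltW.
apply: (le_trans (lee_wpmul2l _ CP)); first by rewrite lee_fin ltW.
rewrite -EFinM lee_fin mulrDr [c * (eta / c)]mulrC divfK ?gt_eqF// mulrA.
by rewrite (_ : (r + p)%:R - r%:R = p%:R)// natrD addrAC subrr add0r.
Qed.

End expected_error.

Theorem theorem16 (R : realType) (dT : measure_display)
    (T : measurableType dT) (P : probability T R) (d m n : nat)
    (D : set 'rV[R]_d) (A : 'rV[R]_d -> 'M[R]_(m, n)) (r p l : nat)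
    (Omega : {RV P >-> 'M[R]_(n, r + p)})
    (Psi : {RV P >-> 'M[R]_(m, r + p + l)}) :
  compact D -> {within D, continuous A} ->
  (2 <= r)%N -> (2 <= p)%N -> (2 <= l)%N ->
  gaussian_matrix Omega -> gaussian_matrix Psi -> independent_RVs Omega Psi ->
  (\int[P]_w \int[lebesgue_rV]_(t in D)
      (frobenius_norm
        ((1%:M - nystrom_proj (A t) (Omega w) (Psi w)) *m A t) ^+ 2)%:E
   <= ((1 + (r + p)%:R / (l%:R - 1)) * (1 + r%:R / (p%:R - 1)))%:E
      * \int[lebesgue_rV]_(t in D)
          (\sum_(r <= j < minn m n) (singular_values (A t))`_j ^+ 2)%:E)%E.
Proof.
move=> cD cA _ p2 l2 gO gP OP.
set c := (1 + _) * _.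
pose tau t : R := \sum_(r <= j < minn m n) (singular_values (A t))`_j ^+ 2.
have c0 : 0 < c.
  rewrite mulr_gt0// ltr_wpDr// divr_ge0// subr_ge0 ler1n.
    exact: ltnW.
  exact: ltnW.
have mD := compact_measurable_rV cD.
(* Continuity is given on [D] only; extension by 0 yields a globally measurable function for
   Tonelli's theorem and an integrand that vanishes off [D]. *)
pose A' t := if t \in D then A t else 0.
have mA' : mx_meas A'.
  move=> i j; rewrite (_ : (fun t => A' t i j) = (fun t => A t i j) \_ D).
    apply: (iffLR (measurable_restrictT _ mD)).
    apply: within_continuous_measurable_rV => // t.
    apply: (@continuous_comp _ _ _ (A : subspace D -> _) (fun M : 'M[R]_(m, n) => M i j)).
      exact: cA.
    exact: coord_continuous.
  by apply/funext => t; rewrite patchE /A'; case: ifP => // _; rewrite mxE.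
pose F w t := nsq ((1%:M - nystrom_proj (A' t) (Omega w) (Psi w)) *m A' t).
have F0 w t : (0 <= (F w t)%:E)%E by rewrite lee_fin nsq_ge0.
have FE w : (\int[lebesgue_rV]_(t in D)
      (frobenius_norm
        ((1%:M - nystrom_proj (A t) (Omega w) (Psi w)) *m A t) ^+ 2)%:E =
    \int[lebesgue_rV]_t (F w t)%:E)%E.
  rewrite integral_mkcond; apply: eq_integral => t _.
  rewrite patchE /F /A' frobenius_norm_sqr; case: ifP => // _.
  by rewrite mulmx0 /nsq mulmx0 mxtrace0.
under eq_integral do rewrite FE.
have mO : measurable_fun setT Omega by exact: measurable_funPT.
have mP : measurable_fun setT Psi by exact: measurable_funPT.
have mF : measurable_fun setT (fun z : T * 'rV[R]_d => (F z.1 z.2)%:E).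
  apply/measurable_EFinP; apply: measurable_nystrom_error => i j.
  - exact: (measurableT_comp (mA' i j) measurable_snd).
  - apply: (measurableT_comp (measurableT_comp (measurable_mx_entry i j) mO)).
    exact: measurable_fst.
  - apply: (measurableT_comp (measurableT_comp (measurable_mx_entry i j) mP)).
    exact: measurable_fst.
rewrite (fubini_tonelli (fun z : T * 'rV[R]_d => (F z.1 z.2)%:E))//=.
have mG := @measurable_fun_fubini_tonelli_G _ _ _ _ R P _ mF (fun z => F0 z.1 z.2).
pose g t := (\int[P]_w (F w t)%:E)%E.
have g0 t : (0 <= g t)%E by exact: integral_ge0.
have ci0 : (0 <= c^-1%:E)%E by rewrite lee_fin invr_ge0 ltW.
(* Measurability is established for [g], not for [tau]. So [c] is extracted by linearity on the side
   of [g], and the comparison with [tau] rests on monotonicity. *)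
have -> : (\int[lebesgue_rV]_t \int[P]_w (F w t)%:E =
    c%:E * \int[lebesgue_rV]_t (c^-1%:E * g t))%E.
  by rewrite ge0_integralZl// muleA -EFinM divff ?gt_eqF// mul1e.
apply: lee_wpmul2l; first by rewrite lee_fin ltW.
rewrite [leRHS]integral_mkcond; apply: ge0_le_lower_integral.
  by move=> t; exact: mule_ge0.
move=> t; rewrite patchE; case: ifPn => tD; last first.
  rewrite (_ : g t = 0)%E ?mule0// /g /F /A' (negPf tD).
  by under eq_integral do rewrite mulmx0 /nsq mulmx0 mxtrace0; rewrite integral0.
apply: (@le_trans _ _ (c^-1%:E * (c * tau t)%:E)%E); last first.
  by rewrite -EFinM mulKf ?gt_eqF.
apply: lee_wpmul2l => //; rewrite /g /F /A' tD.
exact: expected_nystrom_error.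
Qed.
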